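(* Let $\Omega\subset\mathbb{R}^2$ be a domain divided by a $C^2$ curve $\Gamma$ (the interface) lying in $\Omega$ into two open parts $\Omega^+$ and $\Omega^-$, so that $\Omega\setminus\Gamma=\Omega^+\cup\Omega^-$. Let $\mathbf{A}$ be a piecewise constant matrix, i.e. $\mathbf{A}=\mathbf{A}^{+}$ on $\Omega^+$ and $\mathbf{A}=\mathbf{A}^-$ on $\Omega^-$ with $\mathbf{A}^\pm$ constant symmetric positive definite $2\times 2$ matrices. Let $\sigma\ge 0$ and $f$ be continuous on each of $\Omega^\pm$ up to $\Gamma$, and let $u$ be $C^2$ on each of $\Omega^{\pm}$ up to $\Gamma$ (that is, $u|_{\Omega^\pm}$ and its partial derivatives up to order two extend continuously to $\Omega^\pm\cup\Gamma$). Suppose $$\nabla\cdot(\mathbf{A}\nabla u)-\sigma u=f\ \text{ in }\Omega\setminus\Gamma,\qquad [u]=w,\quad [\mathbf{A}\nabla u\cdot\mathbf{n}]=v\ \text{ on }\Gamma,$$ with $w\in C^2$ and $v\in C^1$ along $\Gamma$. Fix a point $(X^*,Y^* )\in\Gamma$ and use the local coordinates $(\xi,\eta)$ at $(X^*,Y^* )$, the local representation $\xi=\chi(\eta)$ of $\Gamma$, and the coefficients $a_{ij}^\pm$ defined in the context. Then the following relations hold at $(X^*,Y^* )$, where superscripts $\pm$ denote limiting values from $\Omega^\pm$, and $w,w',w'',v,v',\chi''$ are evaluated at $s=0$: $$u^{+}=u^{-}+w,$$ $$u_{\xi}^{+}=\frac{a^{-}_{11}}{a^{+}_{11}}u_{\xi}^{-}-\frac{[a_{12}]}{a^{+}_{11}}u_{\eta}^{-}+\frac{1}{a^{+}_{11}}v-\frac{a^{+}_{12}}{a^{+}_{11}}w',$$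 $$u_{\eta}^{+}=u_{\eta}^{-}+w',$$ $$u_{\eta\eta}^{+}=\chi''\frac{[a_{11}]}{a^{+}_{11}}u_{\xi}^{-}+\chi''\frac{[a_{12}]}{a^{+}_{11}}u_{\eta}^{-}+u_{\eta\eta}^{-}-\frac{\chi''}{a^{+}_{11}}v+\chi''\frac{a^{+}_{12}}{a^{+}_{11}}w'+w'',$$ $$u_{\xi\eta}^{+}=\chi''\frac{a^{+}_{11}[a_{12}]-2a^{+}_{12}[a_{11}]}{(a^{+}_{11})^{2}}u_{\xi}^{-}+\chi''\frac{a^{+}_{11}[a_{22}]-2a^{+}_{12}[a_{12}]}{(a^{+}_{11})^{2}}u_{\eta}^{-}+\frac{a^{-}_{11}}{a^{+}_{11}}u_{\xi\eta}^{-}-\frac{[a_{12}]}{a^{+}_{11}}u_{\eta\eta}^{-}+\chi''\frac{2a^{+}_{12}}{(a^{+}_{11})^2}v+\frac{1}{a^{+}_{11}}v'+\chi''\frac{a^{+}_{11}a^{+}_{22}-2(a^{+}_{12})^{2}}{(a^{+}_{11})^2}w'-\frac{a^{+}_{12}}{a^{+}_{11}}w'',$$ $$u_{\xi\xi}^{+}=-S_1\chi''u_{\xi}^{-}-S_2\chi''u_{\eta}^{-}+\frac{a_{11}^{-}}{a_{11}^{+}}u_{\xi\xi}^{-}+\frac{2a_{12}^{+}[a_{12}]-a_{11}^{+}[a_{22}]}{(a_{11}^{+})^{2}}u_{\eta\eta}^{-}+\frac{2\left(a_{12}^{+}[a_{11}]-a_{11}^{+}[a_{12}]\right)}{(a_{11}^{+})^{2}}u_{\xi\eta}^{-}+\frac{[f]}{a_{11}^{+}}+\frac{[\sigma]}{a^{+}_{11}}u^{-}+S_3,$$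 where $$S_1=\frac{2a_{11}^{+}a_{12}^{+}[a_{12}]-4(a_{12}^{+})^{2}[a_{11}]+a_{11}^{+}a_{22}^{+}[a_{11}]}{(a_{11}^{+})^{3}},$$ $$S_2=\frac{2a_{11}^{+}a_{12}^{+}[a_{22}]-4(a_{12}^{+})^{2}[a_{12}]+a_{11}^{+}a_{22}^{+}[a_{12}]}{(a_{11}^{+})^{3}},$$ $$S_3=-\chi''\frac{4(a_{12}^{+})^{2}-a_{11}^{+}a_{22}^{+}}{(a_{11}^{+})^{3}}v-\frac{2a_{12}^{+}}{(a_{11}^{+})^{2}}v'+\frac{\sigma^{+}w}{a^{+}_{11}}-\chi''\frac{3a_{11}^{+}a_{12}^{+}a_{22}^{+}-4(a_{12}^{+})^{3}}{(a_{11}^{+})^{3}}w'+\frac{2(a_{12}^{+})^{2}-a_{11}^{+}a_{22}^{+}}{(a_{11}^{+})^{2}}w''.$$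
   Context: Jump notation: for a quantity $q$ with limiting values $q^\pm$ on $\Gamma$ from $\Omega^\pm$, $[q]=q^+-q^-$. Local coordinates: at $(X^*,Y^* )\in\Gamma$ let the unit normal $\mathbf{n}$ of $\Gamma$ be $(\cos\theta^*,\sin\theta^* )$. Set $$\xi=(x-X^* )\cos\theta^*+(y-Y^* )\sin\theta^*,\qquad \eta=-(x-X^* )\sin\theta^*+(y-Y^* )\cos\theta^*.$$ Near $(X^*,Y^* )$ the interface is the graph $\xi=\chi(\eta)$ with $\chi\in C^2$, $\chi(0)=0$, $\chi'(0)=0$, and is parameterized by $s$ via $\xi=\chi(s)$, $\eta=s$, i.e. $X(s)=X^*+\chi(s)\cos\theta^*-s\sin\theta^*$, $Y(s)=Y^*+\chi(s)\sin\theta^*+s\cos\theta^*$. The unit normal along $\Gamma$ near this point is $$\mathbf{n}(s)=\frac{1}{\sqrt{1+\chi'(s)^2}}\left(\chi'(s)\sin\theta^*+\cos\theta^*,\ -\chi'(s)\cos\theta^*+\sin\theta^*\right).$$ The jump data $w=w(s)$ and $v=v(s)$ are regarded as functions of $s$ along $\Gamma$, and primes denote derivatives with respect to $s$. The same letter $u$ denotes the function in the coordinates $(\xi,\eta)$; $u_\xi,u_\eta,u_{\xi\xi},u_{\xi\eta},u_{\eta\eta}$ are its partial derivatives in these (fixed) coordinates. Transformed coefficients: with $A_{ij}$ the entries of $\mathbf{A}$ (on each side), $$a_{11}=A_{11}\cos^2\theta^*+A_{22}\sin^2\theta^*+2A_{12}\cos\theta^*\sin\theta^*,$$ $$a_{22}=A_{11}\sin^2\theta^*+A_{22}\cos^2\theta^*-2A_{12}\cos\theta^*\sin\theta^*,$$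 $$a_{12}=(A_{22}-A_{11})\cos\theta^*\sin\theta^*+A_{12}(\cos^2\theta^*-\sin^2\theta^* ),$$ so that on each side the PDE reads $a_{11}u_{\xi\xi}+2a_{12}u_{\xi\eta}+a_{22}u_{\eta\eta}-\sigma u=f$; $a_{ij}^\pm$ are the values for $\mathbf{A}^\pm$. *)

(* Defs.v *)
(* Stdlib reals with Coquelicot. *)
From Stdlib Require Import Reals List.
From Coquelicot Require Import Coquelicot.
Open Scope R_scope.

Definition pt : Type := (R * R)%type.

Definition dot (a b : pt) : R := fst a * fst b + snd a * snd b.

Definition entry (M : @matrix R 2 2) (i j : nat) : R := coeff_mat 0 M i j.
Arguments entry M (i j)%_nat_scope.

Definition mulmv (M : @matrix R 2 2) (z : pt) : pt :=
  (entry M 0 0 * fst z + entry M 0 1 * snd z,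
   entry M 1 0 * fst z + entry M 1 1 * snd z).

Definition sym_pos_def (M : @matrix R 2 2) : Prop :=
  entry M 0 1 = entry M 1 0 /\
  forall z : pt, z <> (0, 0) -> 0 < dot z (mulmv M z).

Definition connected (D : pt -> Prop) : Prop :=
  forall U V : pt -> Prop, open U -> open V ->
    (forall z, D z -> U z \/ V z) ->
    (exists z, D z /\ U z) -> (exists z, D z /\ V z) ->
    exists z, D z /\ U z /\ V z.

Definition closure (D : pt -> Prop) (p : pt) : Prop :=
  forall P : pt -> Prop, locally p P -> exists z, D z /\ P z.

(* The limiting values from both sides make sense on all of Gam only if every
   point of Gam adheres to both parts; this excludes, e.g., slits with the same
   part on both sides. *)
Definition divides (Om Gam Omp Omm : pt -> Prop) : Prop :=
  (forall z, Gam z -> Om z) /\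
  open Omp /\ open Omm /\
  (forall z, ~ (Omp z /\ Omm z)) /\
  (forall z, (Om z /\ ~ Gam z) <-> (Omp z \/ Omm z)) /\
  (forall z, Gam z -> closure Omp z /\ closure Omm z).

Definition pd1 (q : pt -> R) (z : pt) : R := Derive (fun t => q (t, snd z)) (fst z).
Definition pd2 (q : pt -> R) (z : pt) : R := Derive (fun t => q (fst z, t)) (snd z).

Definition has_partials (q : pt -> R) (z : pt) : Prop :=
  ex_derive (fun t => q (t, snd z)) (fst z) /\
  ex_derive (fun t => q (fst z, t)) (snd z).

Definition grad (q : pt -> R) (z : pt) : pt := (pd1 q z, pd2 q z).

Definition div (F : pt -> pt) (z : pt) : R :=
  pd1 (fun y => fst (F y)) z + pd2 (fun y => snd (F y)) z.

Definition extends_continuously (D Gam : pt -> Prop) (q : pt -> R) : Prop :=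
  exists g : pt -> R,
    (forall z, D z -> g z = q z) /\
    continuous_on (fun z => D z \/ Gam z) g.

Fixpoint Ck_upto (k : nat) (D Gam : pt -> Prop) (q : pt -> R) : Prop :=
  extends_continuously D Gam q /\
  match k with
  | O => True
  | S k' => (forall z, D z -> has_partials q z) /\
            Ck_upto k' D Gam (pd1 q) /\ Ck_upto k' D Gam (pd2 q)
  end.

Definition has_trace (D : pt -> Prop) (q : pt -> R) (p : pt) : Prop :=
  exists l : R, filterlim q (within D (locally p)) (locally l).

(* The limiting value of q at p from D; meaningful when p adheres to D and
   has_trace D q p holds. *)
Definition trace (D : pt -> Prop) (q : pt -> R) (p : pt) : R :=
  @lim R_CompleteSpace (filtermap q (within D (locally p))).

Definition Ck_near0 (k : nat) (g : R -> R) : Prop :=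
  locally 0 (fun s => forall j : nat, (j <= k)%nat ->
    ex_derive_n g j s /\ continuous (Derive_n g j) s).

(* Inverse of the change to local coordinates at p: the point with local
   coordinates z = (xi, eta). *)
Definition from_local (p : pt) (th : R) (z : pt) : pt :=
  (fst p + fst z * cos th - snd z * sin th,
   snd p + fst z * sin th + snd z * cos th).

Definition curve (p : pt) (th : R) (chi : R -> R) (s : R) : pt :=
  from_local p th (chi s, s).

Definition normal (th : R) (chi : R -> R) (s : R) : pt :=
  ((Derive chi s * sin th + cos th) / sqrt (1 + Derive chi s ^ 2),
   (- Derive chi s * cos th + sin th) / sqrt (1 + Derive chi s ^ 2)).

Definition local_graph (Gam : pt -> Prop) (p : pt) (th : R) (chi : R -> R) : Prop :=
  Ck_near0 2 chi /\ chi 0 = 0 /\ Derive chi 0 = 0 /\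
  locally ((0, 0) : pt)
    (fun z => Gam (from_local p th z) <-> fst z = chi (snd z)).

Definition C2_curve (Gam : pt -> Prop) : Prop :=
  forall p, Gam p -> exists th chi, local_graph Gam p th chi.

(* Since normal th chi 0 = (cos th, sin th), this forces n to be a continuous
   unit normal field; either orientation is allowed. *)
Definition unit_normal_field (Gam : pt -> Prop) (n : pt -> pt) : Prop :=
  forall p, Gam p -> exists th chi,
    local_graph Gam p th chi /\
    locally 0 (fun s => n (curve p th chi s) = normal th chi s).

Definition Ck_along (k : nat) (Gam : pt -> Prop) (g : pt -> R) : Prop :=
  forall p th chi, Gam p -> local_graph Gam p th chi ->
    Ck_near0 k (fun s => g (curve p th chi s)).

Definition a11 (M : @matrix R 2 2) (th : R) : R :=
  entry M 0 0 * cos th ^ 2 + entry M 1 1 * sin th ^ 2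
  + 2 * entry M 0 1 * cos th * sin th.
Definition a22 (M : @matrix R 2 2) (th : R) : R :=
  entry M 0 0 * sin th ^ 2 + entry M 1 1 * cos th ^ 2
  - 2 * entry M 0 1 * cos th * sin th.
Definition a12 (M : @matrix R 2 2) (th : R) : R :=
  (entry M 1 1 - entry M 0 0) * cos th * sin th
  + entry M 0 1 * (cos th ^ 2 - sin th ^ 2).

(* Main.v *)
(* Near a point of the interface the complement of the graph [xi = chi eta]
   consists of two connected strips, one in each part, since both parts adhere to
   the point.  On either side the traces of [u] along the graph are differentiable,
   with the derivative that the chain rule predicts from the traces of the gradient.
   So [[u] = w] may be differentiated twice and [[A grad u . n] = v] once along the
   graph; at [s = 0], where [chi' = 0], these relations and the traces of the PDE
   from the two sides form a linear system that determines the + values. *)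

Require Import Defs.
From Stdlib Require Import Reals List Lra Lia ClassicalEpsilon.
From Coquelicot Require Import Coquelicot.
Import ListNotations.
Open Scope R_scope.

(** * Traces and partial derivatives *)

(** Regularity up to [Gam] only provides continuous extensions of [u] and of each partial derivative
    separately; nothing says that on [Gam] itself the extended partials are derivatives of the
    extended [u], so no chain rule is available there. The graph is therefore pushed into the open
    part by [k * e] in the xi direction, where the chain rule holds, and the mean value theorem
    gives a bound uniform in small [e]. The push requires a whole strip beside the graph to lie in
    one part, hence the connectedness argument. The sign [k] stays unknown: the orientation of the
    normal is not tied to the position of the plus part, and the jump relations do not depend on it.
    Since [trace] is total and meaningful only when a limit exists, the work is done with the
    relation [tends_in], and [trace_eq] converts at the end. *)

Definition tends_in (D : pt -> Prop) (q : pt -> R) (p : pt) (l : R) : Prop :=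
  filterlim q (within D (locally p)) (locally l).

(** This is how adherence is used: on an improper filter every number would be a limit, and traces
    would carry no information. *)
Lemma closure_within_proper (D : pt -> Prop) (p : pt) :
  closure D p -> ProperFilter (within D (locally p)).
Proof.
intros hc; constructor.
- intros P hP; destruct (hc _ hP) as [z [Dz hz]]; exists z; exact (hz Dz).
- apply within_filter, locally_filter.
Qed.

Lemma tends_in_unique D q p l l' :
  closure D p -> tends_in D q p l -> tends_in D q p l' -> l = l'.
Proof.
intros hc; assert (PF := closure_within_proper D p hc).
exact (filterlim_locally_unique (V := R_NormedModule) q l l').
Qed.

(** [lim] is only specified on proper Cauchy filters. An existing limit [l] makes the image filter
    Cauchy, with [l] itself as centre of the small balls; completeness then gives convergence to
    [trace], and uniqueness identifies the two. *)
Lemma trace_eq D q p l : closure D p -> tends_in D q p l -> trace D q p = l.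
Proof.
intros hc hl; assert (PF := closure_within_proper D p hc).
symmetry; apply (tends_in_unique D q p l (trace D q p) hc hl).
assert (PF' : ProperFilter (filtermap q (within D (locally p))))
  by (apply filtermap_proper_filter; exact PF).
assert (hC : cauchy (filtermap q (within D (locally p)))).
{ intros eps; exists l; apply hl; exists eps; auto. }
intros P [eps hP].
generalize (complete_cauchy (T := R_CompleteSpace) _ PF' hC eps).
unfold filtermap; apply filter_imp; intros z hz; apply hP; exact hz.
Qed.

Lemma tends_in_ext (D : pt -> Prop) q q' p l :
  (forall z, D z -> q z = q' z) -> tends_in D q p l -> tends_in D q' p l.
Proof.
intros h; apply filterlim_ext_loc.
apply (filter_forall (F := locally p)); exact h.
Qed.

Lemma tends_in_const D c p : tends_in D (fun _ => c) p c.
Proof. apply filterlim_const. Qed.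

Lemma tends_in_plus D q q' p l l' :
  tends_in D q p l -> tends_in D q' p l' ->
  tends_in D (fun z => q z + q' z) p (l + l').
Proof.
intros h h'.
exact (filterlim_comp_2 _ _ _ h h' (filterlim_plus (V := R_NormedModule) l l')).
Qed.

Lemma tends_in_mult D q q' p l l' :
  tends_in D q p l -> tends_in D q' p l' ->
  tends_in D (fun z => q z * q' z) p (l * l').
Proof.
intros h h'.
exact (filterlim_comp_2 _ _ _ h h' (filterlim_mult (K := R_AbsRing) l l')).
Qed.

Lemma tends_in_lin D q q' p l l' a b :
  tends_in D q p l -> tends_in D q' p l' ->
  tends_in D (fun z => a * q z + b * q' z) p (a * l + b * l').
Proof.
intros h h'; apply tends_in_plus; apply tends_in_mult; auto; apply tends_in_const.
Qed.

Lemma extends_continuously_tends_in (D Gam : pt -> Prop) q p :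
  extends_continuously D Gam q -> Gam p -> closure D p ->
  tends_in D q p (trace D q p).
Proof.
intros [g [hg cg]] hp hc.
assert (h : tends_in D q p (g p)).
{ apply tends_in_ext with g; auto.
  intros P hP; generalize (cg p (or_intror hp) P hP).
  unfold filtermap, within; apply filter_imp; auto. }
now rewrite (trace_eq D q p (g p) hc h).
Qed.

Lemma extends_continuously_continuous (D Gam : pt -> Prop) q z :
  open D -> extends_continuously D Gam q -> D z -> continuous q z.
Proof.
intros oD [g [hg cg]] Dz.
apply continuous_ext_loc with g.
{ generalize (oD z Dz); apply filter_imp; auto. }
intros P hP; generalize (cg z (or_introl Dz) P hP) (oD z Dz).
unfold filtermap, within; intros h1 h2.
generalize (filter_and _ _ h1 h2); apply filter_imp; intros x [a b]; auto.
Qed.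

Lemma extends_continuously_ext (D Gam : pt -> Prop) q q' :
  (forall z, D z -> q z = q' z) ->
  extends_continuously D Gam q -> extends_continuously D Gam q'.
Proof.
intros h [g [hg cg]]; exists g; split; auto.
intros z Dz; rewrite <- h; auto.
Qed.

Lemma extends_continuously_lin (D Gam : pt -> Prop) q q' a b :
  extends_continuously D Gam q -> extends_continuously D Gam q' ->
  extends_continuously D Gam (fun z => a * q z + b * q' z).
Proof.
intros [g [hg cg]] [g' [hg' cg']]; exists (fun z => a * g z + b * g' z); split.
- intros z Dz; rewrite hg, hg'; auto.
- intros z hz; apply tends_in_lin; [apply cg | apply cg']; auto.
Qed.

Lemma continuous_pair (a b : R -> R) x :
  continuous a x -> continuous b x ->
  filterlim (fun t => (a t, b t) : pt) (locally x) (locally ((a x, b x) : pt)).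
Proof.
intros ha hb P [eps hP].
assert (h1 := proj1 (filterlim_locally a (a x)) ha eps).
assert (h2 := proj1 (filterlim_locally b (b x)) hb eps).
unfold filtermap; generalize (filter_and _ _ h1 h2); apply filter_imp.
intros t [A B]; apply hP; split; assumption.
Qed.

Lemma continuous_slice1 (z : pt) :
  filterlim (fun t => (t, snd z) : pt) (locally (fst z)) (locally z).
Proof.
destruct z as [x y].
apply (continuous_pair (fun t => t) (fun _ => y) x);
  [apply continuous_id | apply continuous_const].
Qed.

Lemma continuous_slice2 (z : pt) :
  filterlim (fun t => (fst z, t) : pt) (locally (snd z)) (locally z).
Proof.
destruct z as [x y].
apply (continuous_pair (fun _ => x) (fun t => t) y);
  [apply continuous_const | apply continuous_id].
Qed.

Lemma pd1_ext (D : pt -> Prop) q q' z :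
  open D -> (forall y, D y -> q y = q' y) -> D z -> pd1 q z = pd1 q' z.
Proof.
intros oD h Dz; apply Derive_ext_loc.
generalize (continuous_slice1 z _ (oD z Dz)); unfold filtermap; apply filter_imp; auto.
Qed.

Lemma pd2_ext (D : pt -> Prop) q q' z :
  open D -> (forall y, D y -> q y = q' y) -> D z -> pd2 q z = pd2 q' z.
Proof.
intros oD h Dz; apply Derive_ext_loc.
generalize (continuous_slice2 z _ (oD z Dz)); unfold filtermap; apply filter_imp; auto.
Qed.

Lemma has_partials_ext (D : pt -> Prop) q q' z :
  open D -> (forall y, D y -> q y = q' y) -> D z ->
  has_partials q z -> has_partials q' z.
Proof.
intros oD h Dz [h1 h2]; split.
- revert h1; apply ex_derive_ext_loc.
  generalize (continuous_slice1 z _ (oD z Dz)); unfold filtermap; apply filter_imp; auto.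
- revert h2; apply ex_derive_ext_loc.
  generalize (continuous_slice2 z _ (oD z Dz)); unfold filtermap; apply filter_imp; auto.
Qed.

(** Partial derivatives depend on nearby values, so agreement on [D] passes to them because [D] is
    open. This allows the partials of a transformed function to be replaced by explicit formulas
    valid only on [D]. *)
Lemma Ck_upto_ext (D Gam : pt -> Prop) k q q' :
  open D -> (forall z, D z -> q z = q' z) ->
  Ck_upto k D Gam q -> Ck_upto k D Gam q'.
Proof.
intros oD; revert q q'; induction k as [|k IH]; intros q q' h [he hk].
- split; auto; now apply extends_continuously_ext with q.
- split; [now apply extends_continuously_ext with q|].
  destruct hk as [hp [h1 h2]]; split; [|split].
  + intros z Dz; apply has_partials_ext with D q; auto.
  + apply IH with (pd1 q); auto; intros z Dz; now apply pd1_ext with D.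
  + apply IH with (pd2 q); auto; intros z Dz; now apply pd2_ext with D.
Qed.

Lemma pd_lin q q' a b z :
  has_partials q z -> has_partials q' z ->
  has_partials (fun y => a * q y + b * q' y) z /\
  pd1 (fun y => a * q y + b * q' y) z = a * pd1 q z + b * pd1 q' z /\
  pd2 (fun y => a * q y + b * q' y) z = a * pd2 q z + b * pd2 q' z.
Proof.
intros [h1 h2] [h1' h2'].
assert (E1 : is_derive (fun t => a * q (t, snd z) + b * q' (t, snd z)) (fst z)
               (a * pd1 q z + b * pd1 q' z)).
{ apply (is_derive_plus (V := R_NormedModule));
    apply is_derive_scal, Derive_correct; assumption. }
assert (E2 : is_derive (fun t => a * q (fst z, t) + b * q' (fst z, t)) (snd z)
               (a * pd2 q z + b * pd2 q' z)).
{ apply (is_derive_plus (V := R_NormedModule));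
    apply is_derive_scal, Derive_correct; assumption. }
split; [split; eexists; eassumption|].
split; apply is_derive_unique; assumption.
Qed.

Lemma Ck_upto_lin (D Gam : pt -> Prop) k q q' a b :
  open D -> Ck_upto k D Gam q -> Ck_upto k D Gam q' ->
  Ck_upto k D Gam (fun z => a * q z + b * q' z).
Proof.
intros oD; revert q q'; induction k as [|k IH]; intros q q' [he hk] [he' hk'].
- split; auto; now apply extends_continuously_lin.
- split; [now apply extends_continuously_lin|].
  destruct hk as [hp [h1 h2]], hk' as [hp' [h1' h2']]; split; [|split].
  + intros z Dz; apply pd_lin; auto.
  + apply Ck_upto_ext with (fun z => a * pd1 q z + b * pd1 q' z); auto.
    intros z Dz; symmetry; apply pd_lin; auto.
  + apply Ck_upto_ext with (fun z => a * pd2 q z + b * pd2 q' z); auto.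
    intros z Dz; symmetry; apply pd_lin; auto.
Qed.

Lemma Ck_upto_0 (D Gam : pt -> Prop) k q :
  Ck_upto k D Gam q -> extends_continuously D Gam q.
Proof. destruct k; intros [h _]; exact h. Qed.

Lemma Ck_upto_pred (D Gam : pt -> Prop) k q :
  Ck_upto (S k) D Gam q -> Ck_upto k D Gam q.
Proof.
revert q; induction k as [|k IH]; intros q [h0 [h [h1 h2]]].
- split; auto.
- split; [exact h0|]; auto.
Qed.

(** Total differentiability at a point follows from one partial existing nearby and being continuous
    at the point, together with mere existence of the other. *)
Lemma C1_differentiable (D Gam : pt -> Prop) k q z :
  open D -> Ck_upto (S k) D Gam q -> D z ->
  differentiable_pt_lim (fun x y => q (x, y)) (fst z) (snd z)
    (pd1 q z) (pd2 q z).
Proof.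
intros oD [_ [hp [h1 h2]]] Dz.
apply filterdiff_differentiable_pt_lim.
apply (is_derive_filterdiff (fun x y => q (x, y)) (fst z) (snd z)
  (fun x y => pd1 q (x, y)) (pd2 q z)).
- replace (fst z, snd z) with z by now destruct z.
  generalize (oD z Dz); apply filter_imp; intros y Dy.
  replace (fst y, snd y) with y by now destruct y.
  apply Derive_correct, hp, Dy.
- apply Derive_correct, hp, Dz.
- replace (fst z, snd z) with z by now destruct z.
  apply continuous_ext with (pd1 q); [intros [x y]; reflexivity|].
  apply extends_continuously_continuous with D Gam; auto.
  exact (Ck_upto_0 _ _ _ _ h1).
Qed.

Lemma C1_chain (D Gam : pt -> Prop) k q (a b : R -> R) x a' b' :
  open D -> Ck_upto (S k) D Gam q -> D (a x, b x) ->
  is_derive a x a' -> is_derive b x b' ->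
  is_derive (fun t => q (a t, b t)) x
    (pd1 q (a x, b x) * a' + pd2 q (a x, b x) * b').
Proof.
intros oD hq hD ha hb; apply is_derive_Reals.
apply (derivable_pt_lim_comp_2d (fun x y => q (x, y))).
- exact (C1_differentiable D Gam k q (a x, b x) oD hq hD).
- now apply is_derive_Reals.
- now apply is_derive_Reals.
Qed.

Lemma C2_partials_commute (D Gam : pt -> Prop) q z :
  open D -> Ck_upto 2 D Gam q -> D z -> pd1 (pd2 q) z = pd2 (pd1 q) z.
Proof.
intros oD hq Dz.
destruct hq as [_ [hp [[_ [hp1 [_ h12]]] [_ [hp2 [h21 _]]]]]].
apply (Schwarz (fun x y => q (x, y)) (fst z) (snd z)).
- apply locally_2d_locally.
  replace (fst z, snd z) with z by now destruct z.
  generalize (oD z Dz); apply filter_imp; intros y Dy.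
  destruct (hp y Dy), (hp1 y Dy), (hp2 y Dy); repeat split; assumption.
- apply continuity_2d_pt_filterlim.
  replace (fst z, snd z) with z by now destruct z.
  apply filterlim_ext with (pd1 (pd2 q)); [reflexivity|].
  destruct z; apply extends_continuously_continuous with D Gam; auto.
  exact (proj1 h21).
- apply continuity_2d_pt_filterlim.
  replace (fst z, snd z) with z by now destruct z.
  apply filterlim_ext with (pd2 (pd1 q)); [reflexivity|].
  destruct z; apply extends_continuously_continuous with D Gam; auto.
  exact (proj1 h12).
Qed.

(** * Passage to the rotated coordinates *)

Lemma continuous_from_local (p : pt) th z :
  continuous (from_local p th : pt -> pt) z.
Proof.
apply filterlim_locally; intros eps.
(* Each coordinate of the image moves by a sum of two terms, a coordinate increment times a sine or
   cosine, hence the half. *)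
assert (he : 0 < eps / 2) by (destruct eps; simpl; lra).
exists (mkposreal _ he); intros y [h1 h2].
unfold ball in h1, h2; simpl in h1, h2.
unfold AbsRing_ball, abs, minus, plus, opp in h1, h2; simpl in h1, h2.
assert (hk : forall a k, -1 <= k <= 1 -> Rabs a < eps / 2 -> Rabs (a * k) < eps / 2).
{ intros a k hk ha; rewrite Rabs_mult.
  assert (Rabs k <= 1) by (apply Rabs_le; lra).
  assert (h := Rabs_pos a); nra. }
assert (hc := COS_bound th); assert (hs := SIN_bound th).
assert (B1 := Rabs_def2 _ _ (hk _ _ hc h1)); assert (B2 := Rabs_def2 _ _ (hk _ _ hs h1)).
assert (B3 := Rabs_def2 _ _ (hk _ _ hc h2)); assert (B4 := Rabs_def2 _ _ (hk _ _ hs h2)).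
split; unfold ball; simpl; unfold AbsRing_ball, abs, minus, plus, opp; simpl;
  apply Rabs_def1; lra.
Qed.

Lemma filterlim_from_local (D : pt -> Prop) p th z :
  filterlim (from_local p th)
    (within (fun y => D (from_local p th y)) (locally z))
    (within D (locally (from_local p th z))).
Proof.
intros P hP; generalize (continuous_from_local p th z _ hP).
unfold filtermap, within; unfold filtermap; apply filter_imp; auto.
Qed.

Lemma tends_in_from_local (D : pt -> Prop) q p th z l :
  tends_in D q (from_local p th z) l ->
  tends_in (fun y => D (from_local p th y)) (fun y => q (from_local p th y)) z l.
Proof.
intros h; exact (filterlim_comp _ _ _ _ _ _ _ _ (filterlim_from_local D p th z) h).
Qed.

Lemma open_from_local (D : pt -> Prop) p th :
  open D -> open (fun y => D (from_local p th y)).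
Proof.
intros oD z Dz; exact (continuous_from_local p th z _ (oD _ Dz)).
Qed.

Lemma is_derive_from_local (D Gam : pt -> Prop) k q p th z :
  open D -> Ck_upto (S k) D Gam q -> D (from_local p th z) ->
  is_derive (fun t => q (from_local p th (t, snd z))) (fst z)
    (cos th * pd1 q (from_local p th z) + sin th * pd2 q (from_local p th z)) /\
  is_derive (fun t => q (from_local p th (fst z, t))) (snd z)
    (- sin th * pd1 q (from_local p th z) + cos th * pd2 q (from_local p th z)).
Proof.
intros oD hq Dz; unfold from_local in *; cbn [fst snd] in *; split.
- evar_last.
  + eapply (C1_chain D Gam k q (fun t => fst p + t * cos th - snd z * sin th)
      (fun t => snd p + t * sin th + snd z * cos th)); eauto;
      auto_derive; auto.
  + simpl; ring.
- evar_last.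
  + eapply (C1_chain D Gam k q (fun t => fst p + fst z * cos th - t * sin th)
      (fun t => snd p + fst z * sin th + t * cos th)); eauto;
      auto_derive; auto.
  + simpl; ring.
Qed.

Lemma pd_from_local (D Gam : pt -> Prop) k q p th z :
  open D -> Ck_upto (S k) D Gam q -> D (from_local p th z) ->
  pd1 (fun y => q (from_local p th y)) z =
    cos th * pd1 q (from_local p th z) + sin th * pd2 q (from_local p th z) /\
  pd2 (fun y => q (from_local p th y)) z =
    - sin th * pd1 q (from_local p th z) + cos th * pd2 q (from_local p th z).
Proof.
intros oD hq Dz.
destruct (is_derive_from_local D Gam k q p th z oD hq Dz) as [h1 h2].
split; apply is_derive_unique; assumption.
Qed.

(** The rotation has constant coefficients, so each partial of the composite is a constant
    combination of [pd1 q] and [pd2 q] composed with the same map; the induction hypothesis applies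
    to these two. *)
Lemma Ck_upto_from_local (D Gam : pt -> Prop) k q p th :
  open D -> Ck_upto k D Gam q ->
  Ck_upto k (fun y => D (from_local p th y)) (fun y => Gam (from_local p th y))
    (fun y => q (from_local p th y)).
Proof.
intros oD; assert (oD' := open_from_local D p th oD).
revert q; induction k as [|k IH]; intros q hq.
all: assert (he : extends_continuously (fun y => D (from_local p th y))
  (fun y => Gam (from_local p th y)) (fun y => q (from_local p th y))).
1, 3: destruct hq as [[g [hg cg]] _];
  exists (fun y => g (from_local p th y)); split;
  [intros z Dz; now apply hg
  |intros z hz;
   exact (tends_in_from_local (fun y => D y \/ Gam y) g p th z _ (cg _ hz))].
- split; auto.
- split; auto; split; [|split].
  + intros z Dz.
    destruct (is_derive_from_local D Gam k q p th z oD hq Dz) as [h1 h2].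
    split; eexists; eassumption.
  + destruct (hq) as [_ [_ [h1 h2]]].
    eapply Ck_upto_ext; [exact oD'| |
      apply (Ck_upto_lin _ _ k _ _ (cos th) (sin th) oD' (IH _ h1) (IH _ h2))].
    intros z Dz; symmetry; apply (pd_from_local D Gam k q p th z oD hq Dz).
  + destruct (hq) as [_ [_ [h1 h2]]].
    eapply Ck_upto_ext; [exact oD'| |
      apply (Ck_upto_lin _ _ k _ _ (- sin th) (cos th) oD' (IH _ h1) (IH _ h2))].
    intros z Dz; symmetry; apply (pd_from_local D Gam k q p th z oD hq Dz).
Qed.

(** * The two sides of a graph *)

Lemma segment_in_one_part (D1 D2 : pt -> Prop) (phi : R -> pt) :
  open D1 -> open D2 -> (forall z, ~ (D1 z /\ D2 z)) ->
  (forall t, 0 <= t <= 1 -> filterlim phi (locally t) (locally (phi t))) ->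
  (forall t, 0 <= t <= 1 -> D1 (phi t) \/ D2 (phi t)) ->
  D1 (phi 0) -> D1 (phi 1).
Proof.
intros o1 o2 disj cphi cover h0.
(* A locally constant function on a segment is constant. *)
set (g := fun t => if excluded_middle_informative (D1 (phi t)) then 1 else 0).
assert (dg : forall t, 0 <= t <= 1 -> is_derive g t 0).
{ intros t ht; destruct (cover t ht) as [h|h].
  - apply is_derive_ext_loc with (fun _ => 1).
    + generalize (cphi t ht _ (o1 _ h)); unfold filtermap; apply filter_imp.
      intros x hx; unfold g; destruct excluded_middle_informative; tauto.
    + apply (is_derive_const (V := R_NormedModule)).
  - apply is_derive_ext_loc with (fun _ => 0).
    + generalize (cphi t ht _ (o2 _ h)); unfold filtermap; apply filter_imp.
      intros x hx; unfold g; destruct excluded_middle_informative as [hx'|]; auto.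
      destruct (disj _ (conj hx' hx)).
    + apply (is_derive_const (V := R_NormedModule)). }
destruct (MVT_gen g 0 1 (fun _ => 0)) as [c [_ hc]].
- intros x; rewrite Rmin_left, Rmax_right by lra; intros; apply dg; lra.
- intros x; rewrite Rmin_left, Rmax_right by lra; intros hx.
  apply continuity_pt_filterlim, (ex_derive_continuous (V := R_NormedModule)).
  eexists; apply dg, hx.
- revert hc; unfold g.
  do 2 destruct excluded_middle_informative; try tauto; lra.
Qed.

(** In the parameters [(t, s)] the strip is a rectangle, hence convex: each of its points is joined
    to the midpoint [(d / 2, 0)] by a segment, along which the part cannot change. *)
Lemma strip_in_one_part (D1 D2 : pt -> Prop) (chi : R -> R) (k d : R) :
  open D1 -> open D2 -> (forall z, ~ (D1 z /\ D2 z)) -> 0 < d ->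
  (forall s, Rabs s < d -> continuous chi s) ->
  (forall t s, 0 < t < d -> Rabs s < d ->
     D1 (chi s + k * t, s) \/ D2 (chi s + k * t, s)) ->
  (forall t s, 0 < t < d -> Rabs s < d -> D1 (chi s + k * t, s)) \/
  (forall t s, 0 < t < d -> Rabs s < d -> D2 (chi s + k * t, s)).
Proof.
intros o1 o2 disj hd cchi cover.
assert (key : forall E1 E2 : pt -> Prop, open E1 -> open E2 ->
  (forall z, ~ (E1 z /\ E2 z)) ->
  (forall t s, 0 < t < d -> Rabs s < d ->
     E1 (chi s + k * t, s) \/ E2 (chi s + k * t, s)) ->
  E1 (chi 0 + k * (d / 2), 0) ->
  forall t s, 0 < t < d -> Rabs s < d -> E1 (chi s + k * t, s)).
{ intros E1 E2 p1 p2 pd pc h0 t s ht hs.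
  (* Image of the segment from [(d / 2, 0)] to [(t, s)] under the map that straightens the graph. *)
  set (phi := fun x : R => (chi (x * s) + k * (d / 2 + x * (t - d / 2)), x * s) : pt).
  assert (hx : forall x, 0 <= x <= 1 -> Rabs (x * s) < d).
  { intros x hx; rewrite Rabs_mult, (Rabs_pos_eq x) by lra.
    assert (h := Rabs_pos s); nra. }
  replace (E1 (chi s + k * t, s)) with (E1 (phi 1))
    by (unfold phi; f_equal; f_equal; [f_equal; [f_equal|]|]; field).
  apply segment_in_one_part with E2; auto.
  - intros x hx1; unfold phi.
    apply (continuous_pair (fun x => chi (x * s) + k * (d / 2 + x * (t - d / 2)))
             (fun x => x * s)).
    + apply (continuous_plus (V := R_NormedModule)).
      * apply (continuous_comp (fun x => x * s) chi).
        -- apply (ex_derive_continuous (V := R_NormedModule)); auto_derive; auto.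
        -- apply cchi, hx, hx1.
      * apply (ex_derive_continuous (V := R_NormedModule)); auto_derive; auto.
    + apply (ex_derive_continuous (V := R_NormedModule)); auto_derive; auto.
  - intros x hx1; apply pc; [nra | apply hx, hx1].
  - replace (phi 0) with ((chi 0 + k * (d / 2), 0) : pt); auto.
    unfold phi; rewrite !Rmult_0_l, Rplus_0_r; auto. }
assert (h0 : Rabs 0 < d) by now rewrite Rabs_R0.
destruct (cover (d / 2) 0) as [h|h]; [lra | exact h0 | left | right].
- apply key with D2; auto.
- apply key with D1; auto.
  + intros z [a b]; apply (disj z); auto.
  + intros t s ht hs; destruct (cover t s ht hs); auto.
Qed.

(** Each of the two strips lies in a single part. If both lay in the same part, the other part would
    have no point near the origin, against its adherence; so they lie in different parts, and [k]
    records on which side [D1] is. *)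
Lemma graph_two_sides (D1 D2 : pt -> Prop) (chi : R -> R) :
  open D1 -> open D2 -> (forall z, ~ (D1 z /\ D2 z)) ->
  locally 0 (fun s => continuous chi s) -> chi 0 = 0 ->
  locally ((0, 0) : pt)
    (fun z => fst z <> chi (snd z) <-> D1 z \/ D2 z) ->
  closure D1 (0, 0) -> closure D2 (0, 0) ->
  exists k d, (k = 1 \/ k = -1) /\ 0 < d /\
    forall t s, 0 < t < d -> Rabs s < d ->
      D1 (chi s + k * t, s) /\ D2 (chi s + - k * t, s).
Proof.
intros o1 o2 disj [d0 hc] chi0 [r hr] c1 c2.
assert (cchi : continuous chi 0) by apply hc, ball_center.
assert (hr2 : 0 < r / 2) by (destruct r; simpl; lra).
destruct (proj1 (filterlim_locally chi (chi 0)) cchi (mkposreal _ hr2)) as [d1 hd1].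
rewrite chi0 in hd1.
assert (Hb : forall e x : R, ball 0 e x <-> Rabs x < e).
{ intros e x; unfold ball; simpl; unfold AbsRing_ball, abs, minus, plus, opp; simpl.
  now rewrite Ropp_0, Rplus_0_r. }
(* [d0] keeps [chi] continuous, [d1] keeps its values below [r / 2], and the last bound limits the
   shift; together they keep [(chi s + t, s)] in the ball of radius [r] where the graph is known. *)
set (d := Rmin (Rmin d0 d1) (r / 2)).
assert (hd : 0 < d) by (destruct d0, d1; repeat apply Rmin_glb_lt; auto).
assert (d_d0 : d <= d0) by (eapply Rle_trans; [apply Rmin_l | apply Rmin_l]).
assert (d_d1 : d <= d1) by (eapply Rle_trans; [apply Rmin_l | apply Rmin_r]).
assert (d_r : d <= r / 2) by apply Rmin_r.
assert (side : forall t s, Rabs t < d -> Rabs s < d ->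
  t <> 0 <-> D1 (chi s + t, s) \/ D2 (chi s + t, s)).
{ intros t s ht hs.
  assert (hcs : Rabs (chi s) < r / 2).
  { apply Hb; apply hd1; apply Hb; lra. }
  assert (hz : ball ((0, 0) : pt) r ((chi s + t, s) : pt)).
  { split; apply Hb; simpl; [|lra].
    eapply Rle_lt_trans; [apply Rabs_triang|]; lra. }
  rewrite <- (hr _ hz); simpl; split; intros h1 h2; apply h1; lra. }
assert (cont : forall s, Rabs s < d -> continuous chi s)
  by (intros s hs; apply hc, Hb; lra).
assert (strip : forall k, k = 1 \/ k = -1 ->
  (forall t s, 0 < t < d -> Rabs s < d -> D1 (chi s + k * t, s)) \/
  (forall t s, 0 < t < d -> Rabs s < d -> D2 (chi s + k * t, s))).
{ intros k hk; apply strip_in_one_part; auto.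
  intros t s ht hs; apply side; auto.
  - apply Rabs_def1; destruct hk; subst k; lra.
  - destruct hk; subst k; lra. }
(* If [E1] contains both strips, a point of [E2] close to the origin is either in a strip, so in
   [E1], or on the graph, where [side] puts no point of either part. *)
assert (excl : forall E1 E2 : pt -> Prop, (forall z, ~ (E1 z /\ E2 z)) ->
  (forall z, E2 z -> D1 z \/ D2 z) -> closure E2 (0, 0) ->
  (forall t s, 0 < t < d -> Rabs s < d -> E1 (chi s + 1 * t, s)) ->
  (forall t s, 0 < t < d -> Rabs s < d -> E1 (chi s + -1 * t, s)) -> False).
{ intros E1 E2 ed sub cl h1 h2.
  assert (nb : locally ((0, 0) : pt) (fun z => Rabs (fst z - chi (snd z)) < d /\
                              Rabs (snd z) < d)).
  { assert (hd2 : 0 < d / 2) by lra.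
    destruct (proj1 (filterlim_locally chi (chi 0)) cchi (mkposreal _ hd2))
      as [d2 hd2'].
    rewrite chi0 in hd2'.
    assert (hm : 0 < Rmin d2 (d / 2)) by (destruct d2; apply Rmin_glb_lt; auto).
    assert (m1 := Rmin_l d2 (d / 2)); assert (m2 := Rmin_r d2 (d / 2)).
    exists (mkposreal _ hm); intros [x y] [hx hy].
    apply (proj1 (Hb _ _)) in hx; apply (proj1 (Hb _ _)) in hy; cbn [fst snd pos] in *.
    assert (hcy : Rabs (chi y) < d / 2) by (apply Hb, hd2', Hb; lra).
    split; [|lra].
    eapply Rle_lt_trans; [apply Rabs_triang|]; rewrite Rabs_Ropp; lra. }
  destruct (cl _ nb) as [[x y] [hE [hx hy]]]; cbn [fst snd] in *.
  assert (ex : x = chi y + (x - chi y)) by ring.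
  apply (ed (x, y)); split; auto.
  destruct (Rtotal_order (x - chi y) 0) as [h|[h|h]].
  - replace x with (chi y + -1 * (- (x - chi y))) by ring.
    apply h2; auto; apply Rabs_def2 in hx; lra.
  - exfalso; apply (proj2 (side (x - chi y) y hx hy)); auto.
    rewrite <- ex; auto.
  - replace x with (chi y + 1 * (x - chi y)) by ring.
    apply h1; auto; apply Rabs_def2 in hx; lra. }
destruct (strip 1) as [p1|p1]; auto; destruct (strip (-1)) as [m1|m1]; auto.
- destruct (excl D1 D2); auto.
- exists 1, d; split; [auto|split; [auto|]].
  intros t s ht hs; replace (- (1)) with (-1) by ring; split; auto.
- exists (-1), d; split; [auto|split; [auto|]].
  intros t s ht hs; replace (- -1) with 1 by ring; split; auto.
- destruct (excl D2 D1); auto.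
  intros z [a b]; apply (disj z); auto.
Qed.

(** * Differentiation of traces along the graph *)

(** Composing with this limit turns a trace, which is a limit in two variables, into a limit as [e]
    tends to 0 from the right with [s] fixed. *)
Lemma graph_shift_filterlim (D : pt -> Prop) (chi : R -> R) k d s :
  0 < d -> (forall e, 0 < e < d -> D (chi s + k * e, s)) ->
  filterlim (fun e => (chi s + k * e, s) : pt) (at_right 0)
    (within D (locally ((chi s, s) : pt))).
Proof.
intros hd hD P hP.
assert (hc := continuous_pair (fun e => chi s + k * e) (fun _ => s) 0).
cbv beta in hc; rewrite Rmult_0_r, Rplus_0_r in hc.
assert (hP' : locally 0 (fun e => D (chi s + k * e, s) -> P (chi s + k * e, s))).
{ refine (hc _ _ _ hP);
  apply (ex_derive_continuous (V := R_NormedModule)); auto_derive; auto. }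
unfold filtermap, at_right, within.
assert (hb : locally 0 (fun e : R => Rabs e < d)).
{ exists (mkposreal _ hd); intros y hy.
  unfold ball in hy; simpl in hy; unfold AbsRing_ball, abs, minus, plus, opp in hy.
  simpl in hy; now rewrite Ropp_0, Rplus_0_r in hy. }
generalize (filter_and _ _ hP' hb); apply filter_imp.
intros e [h1 h2] h3; apply h1, hD; apply Rabs_def2 in h2; lra.
Qed.

Lemma closure_graph (D : pt -> Prop) (chi : R -> R) k d s :
  0 < d -> (forall e, 0 < e < d -> D (chi s + k * e, s)) ->
  closure D (chi s, s).
Proof.
intros hd hD P hP.
assert (h := graph_shift_filterlim D chi k d s hd hD (fun z => D z /\ P z)).
destruct (filter_ex (F := at_right 0) _ (h (filter_imp _ _ (fun z hz hDz => conj hDz hz) hP)))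
  as [e he].
eexists; exact he.
Qed.

(** Closedness is what carries a non-strict bound on shifted difference quotients to their limit. *)
Lemma closed_Rabs_sub_le (c M : R) : closed (fun y : R => Rabs (y - c) <= M).
Proof.
apply (closed_comp (fun y : R => Rabs (y - c)) (fun y => y <= M)); [|apply closed_le].
intros y; apply (continuous_comp (fun y : R => y - c) Rabs).
- apply (ex_derive_continuous (V := R_NormedModule)); auto_derive; auto.
- apply continuous_Rabs.
Qed.

(* The mean value theorem on the shifted curves [s |-> (chi s + k e, s)], which
   lie in [D], with a bound that survives the limit [e -> 0+]. *)
Lemma is_derive_limit_along_graph (D Gam : pt -> Prop) j q (chi V : R -> R)
    k d t L1 L2 :
  open D -> Ck_upto (S j) D Gam q ->
  (forall e s, 0 < e < d -> Rabs s < d -> D (chi s + k * e, s)) ->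
  k = 1 \/ k = -1 -> Rabs t < d ->
  (forall s, Rabs s < d -> ex_derive chi s) ->
  continuous (Derive chi) t ->
  (forall s, Rabs s < d -> tends_in D q (chi s, s) (V s)) ->
  tends_in D (pd1 q) (chi t, t) L1 -> tends_in D (pd2 q) (chi t, t) L2 ->
  is_derive V t (L1 * Derive chi t + L2).
Proof.
intros oD hq hD hk ht dchi cchi' hV h1 h2.
set (L := L1 * Derive chi t + L2).
assert (hd : 0 < d) by (assert (h := Rabs_pos t); lra).
(* The shift is constant in [s], so the derivative along every shifted curve is this one function
   evaluated on that curve; its limit at [(chi t, t)] controls all of them at once. *)
assert (hF : tends_in D (fun z => pd1 q z * Derive chi (snd z) + pd2 q z) (chi t, t) L).
{ apply tends_in_plus; auto; apply tends_in_mult; auto.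
  intros P hP; apply filter_le_within.
  apply (continuous_comp (snd : R * R -> R) (Derive chi) (chi t, t)); auto.
  apply continuous_snd. }
apply is_derive_Reals; intros eps heps.
assert (heps2 : 0 < eps / 2) by lra.
destruct (proj1 (filterlim_locally _ _) hF (mkposreal _ heps2)) as [r hr].
assert (hr2 : 0 < r / 2) by (destruct r; simpl; lra).
assert (cchi : continuous chi t)
  by (apply (ex_derive_continuous (V := R_NormedModule)); auto).
destruct (proj1 (filterlim_locally chi (chi t)) cchi (mkposreal _ hr2)) as [d1 hd1].
assert (Hb : forall c e x : R, ball c e x <-> Rabs (x - c) < e) by reflexivity.
(* The first two bounds keep the graph point over [s] within [r / 2] of the one over [t]; the last
   keeps [s] in the interval where the strip is available. *)
set (dl := Rmin (Rmin d1 (r / 2)) (d - Rabs t)).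
assert (hdl : 0 < dl) by (destruct d1; repeat apply Rmin_glb_lt; simpl; lra).
assert (dl1 : dl <= d1) by (eapply Rle_trans; [apply Rmin_l | apply Rmin_l]).
assert (dl2 : dl <= r / 2) by (eapply Rle_trans; [apply Rmin_l | apply Rmin_r]).
assert (dl3 : dl <= d - Rabs t) by apply Rmin_r.
exists (mkposreal _ hdl); intros h hn0 hh; simpl in hh.
assert (near : forall s, Rabs (s - t) < dl -> Rabs s < d).
{ intros s hs; replace s with ((s - t) + t) by ring.
  eapply Rle_lt_trans; [apply Rabs_triang|]; lra. }
assert (hth : Rabs (t + h) < d) by (apply near; now replace (t + h - t) with h by ring).
assert (shift : forall s, Rabs s < d ->
  filterlim (fun e => q (chi s + k * e, s)) (at_right 0) (locally (V s))).
{ intros s hs; apply (filterlim_comp _ _ _ (fun e => (chi s + k * e, s)) q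
    (at_right 0) (within D (locally (chi s, s)))).
  - apply graph_shift_filterlim with d; auto.
  - apply hV, hs. }
assert (lim : filterlim (fun e => q (chi (t + h) + k * e, t + h) - q (chi t + k * e, t))
  (at_right 0) (locally (V (t + h) - V t))).
{ refine (filterlim_comp_2 _ _ _ (shift _ hth) (filterlim_comp _ _ _ _ _ _ _ _ (shift _ ht)
     (filterlim_opp (V := R_NormedModule) (V t)))
     (filterlim_plus (V := R_NormedModule) (V (t + h)) (- V t))). }
(* Only a non-strict inequality survives the limit in [e], so [eps / 2] is aimed at to obtain a
   strict bound by [eps] after division by [h]. *)
assert (bound : Rabs (V (t + h) - V t - L * h) <= eps / 2 * Rabs h).
{ apply (closed_filterlim_loc _ (fun y => Rabs (y - L * h) <= eps / 2 * Rabs h) _ lim);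
    [|apply closed_Rabs_sub_le].
  (* [e < d] keeps the shifted curve in [D], and [e < r / 2] spends the other half of the radius
     [r]. *)
  set (m := Rmin d (r / 2)).
  assert (hm : 0 < m) by (apply Rmin_glb_lt; auto).
  assert (m1 : m <= d) by apply Rmin_l; assert (m2 : m <= r / 2) by apply Rmin_r.
  exists (mkposreal _ hm); intros e he epos; simpl.
  apply (proj1 (Hb _ _ _)) in he; simpl in he; rewrite Rminus_0_r, Rabs_pos_eq in he by lra.
  set (G := fun z : pt => pd1 q z * Derive chi (snd z) + pd2 q z) in *.
  assert (dq : forall s, Rabs s < d ->
    is_derive (fun s => q (chi s + k * e, s)) s (G (chi s + k * e, s))).
  { intros s hs; unfold G; evar_last.
    - apply (C1_chain D Gam j q (fun s => chi s + k * e) (fun s => s) s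
               (Derive chi s) 1); auto.
      + apply hD; lra.
      + evar_last; [apply (is_derive_plus (V := R_NormedModule));
          [apply Derive_correct, dchi, hs | apply is_derive_const] |].
        apply Rplus_0_r.
      + apply (is_derive_id (K := R_AbsRing)).
    - simpl; ring. }
  assert (btw : forall c, Rmin t (t + h) <= c <= Rmax t (t + h) -> Rabs (c - t) < dl).
  { intros c; apply Rabs_def2 in hh.
    destruct (Rle_dec 0 h).
    - rewrite Rmin_left, Rmax_right by lra; intros; apply Rabs_def1; lra.
    - rewrite Rmin_right, Rmax_left by lra; intros; apply Rabs_def1; lra. }
  destruct (MVT_gen (fun s => q (chi s + k * e, s)) t (t + h)
    (fun s => G (chi s + k * e, s))) as [c [hc Ec]].
  - intros s hs; apply dq, near, btw; lra.
  - intros s hs; apply continuity_pt_filterlim,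
      (ex_derive_continuous (V := R_NormedModule)).
    eexists; apply dq, near, btw, hs.
  - rewrite Ec; replace (t + h - t) with h by ring.
    rewrite <- Rmult_minus_distr_r, Rabs_mult.
    apply Rmult_le_compat_r; [apply Rabs_pos|].
    apply Rlt_le, (hr (chi c + k * e, c)).
    + assert (hcc := btw c hc); split; apply Hb; simpl; [|lra].
      replace (chi c + k * e - chi t) with ((chi c - chi t) + k * e) by ring.
      eapply Rle_lt_trans; [apply Rabs_triang|].
      assert (Rabs (chi c - chi t) < r / 2) by (apply (hd1 c), Hb; lra).
      assert (Rabs (k * e) < r / 2)
        by (destruct hk; subst k; apply Rabs_def1; lra).
      lra.
    + apply hD; [lra | apply near, btw, hc]. }
replace ((V (t + h) - V t) / h - L) with ((V (t + h) - V t - L * h) / h) by now field.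
unfold Rdiv; rewrite Rabs_mult, Rabs_inv.
assert (hpos : 0 < Rabs h) by now apply Rabs_pos_lt.
apply Rle_lt_trans with (eps / 2); [|lra].
apply Rmult_le_reg_r with (Rabs h); auto.
rewrite Rmult_assoc, Rinv_l, Rmult_1_r by lra; exact bound.
Qed.

(** * The equations in local coordinates *)

Lemma cos2_sin2 th : cos th ^ 2 + sin th ^ 2 = 1.
Proof. assert (h := sin2_cos2 th); unfold Rsqr in h; lra. Qed.

Lemma from_local_origin p th : from_local p th (0, 0) = p.
Proof. destruct p as [x y]; unfold from_local; cbn [fst snd]; f_equal; ring. Qed.

(** The inverse of a rigid motion is a rigid motion: rotation by [- th], with base point the
    negative of [p] rotated by [- th]. Having the same form, it is covered by the same continuity
    lemma. *)
Lemma from_local_inverse p th :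
  exists p', (forall y, from_local p th (from_local p' (- th) y) = y) /\
             (forall z, from_local p' (- th) (from_local p th z) = z).
Proof.
exists (- fst p * cos th - snd p * sin th, fst p * sin th - snd p * cos th).
assert (h := cos2_sin2 th).
assert (hr : forall c x, c + (cos th ^ 2 + sin th ^ 2) * (x - c) = x)
  by (intros; rewrite h; ring).
split; intros [x y]; unfold from_local; rewrite cos_neg, sin_neg; cbn [fst snd];
  f_equal.
- rewrite <- (hr (fst p) x) at 3; ring.
- rewrite <- (hr (snd p) y) at 3; ring.
- rewrite <- (hr 0 x) at 3; ring.
- rewrite <- (hr 0 y) at 3; ring.
Qed.

Lemma closure_from_local (D : pt -> Prop) p th z :
  closure (fun y => D (from_local p th y)) z <-> closure D (from_local p th z).
Proof.
split; intros hc P hP.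
- destruct (hc _ (continuous_from_local p th z _ hP)) as [y [hy hPy]].
  exists (from_local p th y); auto.
- destruct (from_local_inverse p th) as [p' [h1 h2]].
  rewrite <- (h2 z) in hP.
  destruct (hc _ (continuous_from_local p' (- th) _ _ hP)) as [y [hy hPy]].
  exists (from_local p' (- th) y); rewrite h1; auto.
Qed.

Lemma trace_from_local (D Gam : pt -> Prop) q p th z :
  extends_continuously D Gam q -> Gam (from_local p th z) ->
  closure D (from_local p th z) ->
  trace (fun y => D (from_local p th y)) (fun y => q (from_local p th y)) z =
  trace D q (from_local p th z).
Proof.
intros he hG hc; apply trace_eq.
- now apply closure_from_local.
- apply tends_in_from_local, extends_continuously_tends_in with Gam; auto.
Qed.

(** The local traces are obtained first, by passing to the limit in the rotated gradient; the stated
    relations come from inverting the rotation. *)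
Lemma trace_pd_from_local (D Gam : pt -> Prop) q p th z :
  open D -> Ck_upto 1 D Gam q -> Gam (from_local p th z) ->
  closure D (from_local p th z) ->
  let ql := fun y => q (from_local p th y) in
  let Dl := fun y => D (from_local p th y) in
  trace D (pd1 q) (from_local p th z) =
    cos th * trace Dl (pd1 ql) z - sin th * trace Dl (pd2 ql) z /\
  trace D (pd2 q) (from_local p th z) =
    sin th * trace Dl (pd1 ql) z + cos th * trace Dl (pd2 ql) z.
Proof.
intros oD hq hG hc ql Dl.
assert (hc' : closure Dl z) by now apply closure_from_local.
assert (h1 : tends_in D (pd1 q) (from_local p th z) (trace D (pd1 q) (from_local p th z)))
  by (apply extends_continuously_tends_in with Gam; auto; apply hq).
assert (h2 : tends_in D (pd2 q) (from_local p th z) (trace D (pd2 q) (from_local p th z)))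
  by (apply extends_continuously_tends_in with Gam; auto; apply hq).
set (g1 := trace D (pd1 q) _) in *; set (g2 := trace D (pd2 q) _) in *.
apply tends_in_from_local in h1; apply tends_in_from_local in h2.
rewrite (trace_eq Dl (pd1 ql) z (cos th * g1 + sin th * g2) hc').
rewrite (trace_eq Dl (pd2 ql) z (- sin th * g1 + cos th * g2) hc').
- assert (hx : forall x, x = (cos th ^ 2 + sin th ^ 2) * x)
    by (intros; rewrite cos2_sin2; ring).
  split; [rewrite (hx g1) at 1 | rewrite (hx g2) at 1]; ring.
- eapply tends_in_ext; [|apply (tends_in_lin _ _ _ _ _ _ (- sin th) (cos th) h1 h2)].
  intros y Dy; symmetry; apply (pd_from_local D Gam 0 q p th y oD hq Dy).
- eapply tends_in_ext; [|apply (tends_in_lin _ _ _ _ _ _ (cos th) (sin th) h1 h2)].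
  intros y Dy; symmetry; apply (pd_from_local D Gam 0 q p th y oD hq Dy).
Qed.

(** In the rotated frame the normal is [(1, - chi')] divided by its length, and [a11], [a12], [a22]
    are the entries of the rotated matrix. The normal is frozen while the point moves in [D], so the
    flux is a fixed combination of the two partials. *)
Lemma trace_flux (D Gam : pt -> Prop) A M u p th (chi : R -> R) s z :
  open D -> Ck_upto 1 D Gam u -> Gam (from_local p th z) ->
  closure D (from_local p th z) ->
  (forall y, D y -> A y = M) -> entry M 0 1 = entry M 1 0 ->
  let ul := fun y => u (from_local p th y) in
  let Dl := fun y => D (from_local p th y) in
  trace D (fun y => dot (mulmv (A y) (grad u y)) (normal th chi s)) (from_local p th z) =
  (a11 M th * trace Dl (pd1 ul) z + a12 M th * trace Dl (pd2 ul) z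
   - Derive chi s * (a12 M th * trace Dl (pd1 ul) z + a22 M th * trace Dl (pd2 ul) z))
  / sqrt (1 + Derive chi s ^ 2).
Proof.
intros oD hu hG hc hA sym ul Dl.
destruct (trace_pd_from_local D Gam u p th z oD hu hG hc) as [E1 E2].
assert (h1 : tends_in D (pd1 u) (from_local p th z) (trace D (pd1 u) (from_local p th z)))
  by (apply extends_continuously_tends_in with Gam; auto; apply hu).
assert (h2 : tends_in D (pd2 u) (from_local p th z) (trace D (pd2 u) (from_local p th z)))
  by (apply extends_continuously_tends_in with Gam; auto; apply hu).
set (N := normal th chi s).
assert (h := tends_in_lin _ _ _ _ _ _ (fst N) (snd N)
  (tends_in_lin _ _ _ _ _ _ (entry M 0 0) (entry M 0 1) h1 h2)
  (tends_in_lin _ _ _ _ _ _ (entry M 1 0) (entry M 1 1) h1 h2)).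
apply (tends_in_ext D _ (fun y => dot (mulmv (A y) (grad u y)) N)) in h.
- rewrite (trace_eq _ _ _ _ hc h), E1, E2; fold ul Dl.
  unfold N, normal, a11, a12, a22; cbn [fst snd]; rewrite sym.
  unfold Rdiv; ring.
- intros y Dy; rewrite (hA y Dy); unfold dot, mulmv, grad; cbn [fst snd]; ring.
Qed.

Lemma div_const_matrix (D Gam : pt -> Prop) A M u z :
  open D -> Ck_upto 2 D Gam u -> (forall y, D y -> A y = M) ->
  entry M 0 1 = entry M 1 0 -> D z ->
  div (fun y => mulmv (A y) (grad u y)) z =
  entry M 0 0 * pd1 (pd1 u) z + 2 * entry M 0 1 * pd2 (pd1 u) z
  + entry M 1 1 * pd2 (pd2 u) z.
Proof.
intros oD hu hA sym Dz.
assert (sch := C2_partials_commute D Gam u z oD hu Dz).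
destruct hu as [_ [_ [[_ [hp1 _]] [_ [hp2 _]]]]].
unfold div.
rewrite (pd1_ext D _ (fun y => entry M 0 0 * pd1 u y + entry M 0 1 * pd2 u y) z oD); auto.
2: intros y Dy; rewrite (hA y Dy); reflexivity.
rewrite (pd2_ext D _ (fun y => entry M 1 0 * pd1 u y + entry M 1 1 * pd2 u y) z oD); auto.
2: intros y Dy; rewrite (hA y Dy); reflexivity.
destruct (pd_lin (pd1 u) (pd2 u) (entry M 0 0) (entry M 0 1) z (hp1 z Dz) (hp2 z Dz))
  as [_ [-> _]].
destruct (pd_lin (pd1 u) (pd2 u) (entry M 1 0) (entry M 1 1) z (hp1 z Dz) (hp2 z Dz))
  as [_ [_ ->]].
rewrite sch, sym; ring.
Qed.

(** Both sides are the trace of the product of the matrix and the Hessian of [u], which does not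
    change when both are rotated. *)
Lemma second_partials_from_local (D Gam : pt -> Prop) u M p th z :
  open D -> Ck_upto 2 D Gam u -> D (from_local p th z) ->
  let ul := fun y => u (from_local p th y) in
  a11 M th * pd1 (pd1 ul) z + 2 * a12 M th * pd2 (pd1 ul) z + a22 M th * pd2 (pd2 ul) z =
  entry M 0 0 * pd1 (pd1 u) (from_local p th z)
  + 2 * entry M 0 1 * pd2 (pd1 u) (from_local p th z)
  + entry M 1 1 * pd2 (pd2 u) (from_local p th z).
Proof.
intros oD hu Dz ul.
assert (oD' := open_from_local D p th oD).
assert (sch := C2_partials_commute D Gam u _ oD hu Dz).
assert (hul := Ck_upto_from_local D Gam 2 u p th oD hu).
destruct (hu) as [_ [_ [c1 c2]]].
assert (k1 := Ck_upto_from_local D Gam 1 _ p th oD c1).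
assert (k2 := Ck_upto_from_local D Gam 1 _ p th oD c2).
destruct k1 as [_ [k1 _]]; destruct k2 as [_ [k2 _]].
destruct (pd_from_local D Gam 0 (pd1 u) p th z oD c1 Dz) as [e11 e12].
destruct (pd_from_local D Gam 0 (pd2 u) p th z oD c2 Dz) as [e21 e22].
destruct (pd_lin _ _ (cos th) (sin th) z (k1 z Dz) (k2 z Dz)) as [_ [f1 f2]].
destruct (pd_lin _ _ (- sin th) (cos th) z (k1 z Dz) (k2 z Dz)) as [_ [_ f4]].
assert (g1 := fun y Dy => proj1 (pd_from_local D Gam 1 u p th y oD hu Dy)).
assert (g2 := fun y Dy => proj2 (pd_from_local D Gam 1 u p th y oD hu Dy)).
unfold ul; rewrite (pd1_ext _ _ _ z oD' g1 Dz), (pd2_ext _ _ _ z oD' g1 Dz),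
  (pd2_ext _ _ _ z oD' g2 Dz), f1, f2, f4, e11, e12, e21, e22, sch.
set (u11 := pd1 (pd1 u) _); set (u12 := pd2 (pd1 u) _); set (u22 := pd2 (pd2 u) _).
(* The rotated side has degree four in sine and cosine, two from the coefficients and two from the
   second partials; this factor gives the other side the same degree, after which the identity is
   purely polynomial. *)
assert (hx : forall x, x = (cos th ^ 2 + sin th ^ 2) ^ 2 * x)
  by (intros; rewrite cos2_sin2; ring).
rewrite (hx (_ + entry M 1 1 * u22)); unfold a11, a12, a22; ring.
Qed.

Lemma trace_pde (D Gam : pt -> Prop) A M sigma f u p th z :
  open D -> Ck_upto 2 D Gam u ->
  extends_continuously D Gam sigma -> extends_continuously D Gam f ->
  (forall y, D y -> A y = M) -> entry M 0 1 = entry M 1 0 ->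
  (forall y, D y -> div (fun y => mulmv (A y) (grad u y)) y - sigma y * u y = f y) ->
  Gam (from_local p th z) -> closure D (from_local p th z) ->
  let ul := fun y => u (from_local p th y) in
  let Dl := fun y => D (from_local p th y) in
  a11 M th * trace Dl (pd1 (pd1 ul)) z + 2 * a12 M th * trace Dl (pd2 (pd1 ul)) z
  + a22 M th * trace Dl (pd2 (pd2 ul)) z
  - trace D sigma (from_local p th z) * trace Dl ul z = trace D f (from_local p th z).
Proof.
intros oD hu hs hf hA sym pde hG hc ul Dl.
assert (hc' : closure Dl z) by now apply closure_from_local.
assert (hul := Ck_upto_from_local D Gam 2 u p th oD hu).
assert (T : forall q, extends_continuously Dl (fun y => Gam (from_local p th y)) q ->
  tends_in Dl q z (trace Dl q z))
  by (intros q hq; apply extends_continuously_tends_in with (1 := hq); auto).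
assert (hs' := tends_in_from_local D sigma p th z _
  (extends_continuously_tends_in D Gam sigma _ hs hG hc)).
assert (hf' := tends_in_from_local D f p th z _
  (extends_continuously_tends_in D Gam f _ hf hG hc)).
destruct hul as [h0 [_ [[_ [_ [[h11 _] [h12 _]]]] [_ [_ [_ [h22 _]]]]]]].
apply (tends_in_unique Dl (fun y => f (from_local p th y)) z); auto.
assert (h := tends_in_lin _ _ _ _ _ _ 1 (-1)
  (tends_in_plus _ _ _ _ _ _
    (tends_in_lin _ _ _ _ _ _ (a11 M th) (2 * a12 M th) (T _ h11) (T _ h12))
    (tends_in_mult _ _ _ _ _ _ (tends_in_const Dl (a22 M th) z) (T _ h22)))
  (tends_in_mult _ _ _ _ _ _ hs' (T _ h0))).
match type of h with tends_in _ _ _ ?l => match goal with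
  |- tends_in _ _ _ ?l' => replace l' with l by (unfold ul, Dl; ring) end end.
revert h; apply tends_in_ext; intros y Dy.
rewrite <- (pde _ Dy), (div_const_matrix D Gam A M u _ oD hu hA sym Dy).
rewrite <- (second_partials_from_local D Gam u M p th y oD hu Dy); ring.
Qed.

(** The field is described by some frame and graph function at [p], not necessarily the given ones.
    Equal normals at [p] force equal sine and cosine, hence the same frame (the angles may differ by
    a full turn); then both functions describe [Gam] in that frame and coincide near 0. *)
Lemma unit_normal_field_graph (Gam : pt -> Prop) n p th chi :
  unit_normal_field Gam n -> Gam p -> n p = (cos th, sin th) ->
  local_graph Gam p th chi ->
  locally 0 (fun s => n (curve p th chi s) = normal th chi s).
Proof.
intros hn hp hth [hC [h0 [h1 hl]]].
destruct (hn p hp) as [th' [chi' [[hC' [h0' [h1' hl']]] hnn]]].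
assert (E := locally_singleton _ _ hnn).
unfold curve, normal in E; rewrite h0', h1', from_local_origin, hth in E.
replace (1 + 0 ^ 2) with 1 in E by ring; rewrite sqrt_1 in E.
injection E as Ec Es.
replace ((0 * sin th' + cos th') / 1) with (cos th') in Ec by field.
replace ((- 0 * cos th' + sin th') / 1) with (sin th') in Es by field.
assert (EL : forall z, from_local p th' z = from_local p th z)
  by (intros z; unfold from_local; now rewrite Ec, Es).
assert (cchi : continuous chi 0).
{ apply (ex_derive_continuous (V := R_NormedModule)).
  apply (proj1 (locally_singleton _ _ hC 1%nat ltac:(lia))). }
assert (hz : filterlim (fun s => (chi s, s) : pt) (locally 0) (locally ((0, 0) : pt))).
{ assert (h := continuous_pair chi (fun s => s) 0 cchi (continuous_id 0)).
  cbv beta in h; now rewrite h0 in h. }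
assert (Echi : locally 0 (fun s => chi s = chi' s)).
{ unfold filtermap in hz; generalize (filter_and _ _ (hz _ hl) (hz _ hl')); unfold filtermap; apply filter_imp.
  intros s [a b]; cbn [fst snd] in a, b; apply b; rewrite EL; now apply a. }
(* Equality around each nearby [s], not just at [s], is required for the derivatives in the normals
   to agree. *)
generalize (filter_and _ _ (locally_locally _ _ Echi) hnn); apply filter_imp.
intros s [a b].
assert (D' : Derive chi s = Derive chi' s) by now apply Derive_ext_loc.
unfold curve, normal in *; rewrite EL in b.
now rewrite D', (locally_singleton _ _ a), b, Ec, Es.
Qed.

(** With [g] standing for [chi'], the condition [g 0 = 0] makes the normalizing root equal to 1 with
    zero derivative at 0, and leaves only [g'] times the tangential factor from the product. *)
Lemma flux_is_derive_0 (P Q g : R -> R) b11 b12 b22 P' Q' g' :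
  is_derive P 0 P' -> is_derive Q 0 Q' -> is_derive g 0 g' -> g 0 = 0 ->
  is_derive (fun s => (b11 * P s + b12 * Q s - g s * (b12 * P s + b22 * Q s))
                      / sqrt (1 + g s ^ 2)) 0
    (b11 * P' + b12 * Q' - g' * (b12 * P 0 + b22 * Q 0)).
Proof.
intros hP hQ hg g0.
assert (EP := is_derive_unique _ _ _ hP); assert (EQ := is_derive_unique _ _ _ hQ).
assert (Eg := is_derive_unique _ _ _ hg).
evar_last.
- auto_derive; [|reflexivity].
  assert (ex_derive P 0) by (eexists; eassumption).
  assert (ex_derive Q 0) by (eexists; eassumption).
  assert (ex_derive g 0) by (eexists; eassumption).
  rewrite g0; replace (1 + 0 * (0 * 1)) with 1 by ring; rewrite sqrt_1.
  repeat split; auto; lra.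
- change (Derive (fun x => P x) 0) with (Derive P 0).
  change (Derive (fun x => Q x) 0) with (Derive Q 0).
  change (Derive (fun x => g x) 0) with (Derive g 0).
  rewrite EP, EQ, Eg, g0; replace (1 + 0 ^ 2) with 1 by ring.
  rewrite ?Rmult_0_l, ?Rplus_0_r, sqrt_1; field.
Qed.

(** * Jump relations *)

(** The system is triangular: the jump of [u] and its first derivative give [up] and [ep], the flux
    gives [xp], the second derivative of the jump gives [eep], the differentiated flux gives [xep],
    and the equation gives [xxp]. The only divisor is [p11]; [c] stands for the second derivative of
    [chi] at 0. *)
Lemma jump_algebra (p11 p12 p22 m11 m12 m22 um up xm xp em ep xxm xxp xem xep eem eep w0 w1 w2 v0 v1 c sp sm fp fm : R) :
 0 < p11 -> up - um = w0 -> ep - em = w1 ->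
 (xp - xm) * c + (eep - eem) = w2 ->
 (p11 * xp + p12 * ep) - (m11 * xm + m12 * em) = v0 ->
 (p11 * xep + p12 * eep - c * (p12 * xp + p22 * ep)) - (m11 * xem + m12 * eem - c * (m12 * xm + m22 * em)) = v1 ->
 p11 * xxp + 2 * p12 * xep + p22 * eep - sp * up = fp ->
 m11 * xxm + 2 * m12 * xem + m22 * eem - sm * um = fm ->
  let j11 := p11 - m11 in
  let j12 := p12 - m12 in
  let j22 := p22 - m22 in
  let S1 := (2 * p11 * p12 * j12 - 4 * p12 ^ 2 * j11 + p11 * p22 * j11)
            / p11 ^ 3 in
  let S2 := (2 * p11 * p12 * j22 - 4 * p12 ^ 2 * j12 + p11 * p22 * j12)
            / p11 ^ 3 in
  let S3 := - c * ((4 * p12 ^ 2 - p11 * p22) / p11 ^ 3) * v0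
            - 2 * p12 / p11 ^ 2 * v1
            + sp * w0 / p11
            - c * ((3 * p11 * p12 * p22 - 4 * p12 ^ 3) / p11 ^ 3) * w1
            + (2 * p12 ^ 2 - p11 * p22) / p11 ^ 2 * w2 in
 up = um + w0 /\
 xp = m11 / p11 * xm - j12 / p11 * em + 1 / p11 * v0 - p12 / p11 * w1 /\
 ep = em + w1 /\
 eep = c * (j11 / p11) * xm + c * (j12 / p11) * em + eem
          - c / p11 * v0 + c * (p12 / p11) * w1 + w2 /\
 xep = c * ((p11 * j12 - 2 * p12 * j11) / p11 ^ 2) * xm
          + c * ((p11 * j22 - 2 * p12 * j12) / p11 ^ 2) * em
          + m11 / p11 * xem - j12 / p11 * eem
          + c * (2 * p12 / p11 ^ 2) * v0 + 1 / p11 * v1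
          + c * ((p11 * p22 - 2 * p12 ^ 2) / p11 ^ 2) * w1
          - p12 / p11 * w2 /\
  xxp = - S1 * c * xm - S2 * c * em + m11 / p11 * xxm
          + (2 * p12 * j12 - p11 * j22) / p11 ^ 2 * eem
          + 2 * (p12 * j11 - p11 * j12) / p11 ^ 2 * xem
          + (fp - fm) / p11 + (sp - sm) / p11 * um + S3.
Proof.
intros hp H0 H1 H2 H3 H4 H5 H6 j11 j12 j22 S1 S2 S3.
assert (Ex : xp = (v0 - p12 * ep + (m11 * xm + m12 * em)) / p11) by (field_simplify_eq; lra).
assert (Exe : xep = (v1 - p12 * eep + c * (p12 * xp + p22 * ep) + (m11 * xem + m12 * eem - c * (m12 * xm + m22 * em))) / p11) by (field_simplify_eq; lra).
assert (Exx : xxp = (fp + sp * up - 2 * p12 * xep - p22 * eep) / p11) by (field_simplify_eq; lra).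
assert (Ee : ep = em + w1) by lra.
assert (Eu : up = um + w0) by lra.
assert (Eee : eep = eem + w2 - (xp - xm) * c) by lra.
subst up ep fm; clear H0 H1 H2 H3 H4 H5.
unfold S1, S2, S3, j11, j12, j22.
(* Substitution runs against the order of solution, so that every remaining plus unknown is
   eliminated. *)
rewrite Exx, Exe, Eee, Ex.
repeat split; field; lra.
Qed.

(** [a11] is the quadratic form of [M] at the unit vector [(cos th, sin th)]. *)
Lemma a11_pos M th : sym_pos_def M -> 0 < a11 M th.
Proof.
intros [sym pos].
assert (hn : (cos th, sin th) <> (0, 0)).
{ intros E; injection E as Ec Es; assert (h := cos2_sin2 th).
  rewrite Ec, Es in h; lra. }
assert (h := pos _ hn); unfold dot, mulmv in h; cbn [fst snd] in h.
unfold a11; rewrite <- sym in h; lra.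
Qed.

Lemma local_parts (Om Gam Omp Omm : pt -> Prop) p th chi :
  open Om -> divides Om Gam Omp Omm -> Gam p -> local_graph Gam p th chi ->
  exists k d, (k = 1 \/ k = -1) /\ 0 < d /\
    forall t s, 0 < t < d -> Rabs s < d ->
      Omp (from_local p th (chi s + k * t, s)) /\
      Omm (from_local p th (chi s + - k * t, s)).
Proof.
intros oOm [hGO [op [om [disj [hpart hcl]]]]] hp [hC [h0 [_ hl]]].
apply (graph_two_sides (fun z => Omp (from_local p th z))
         (fun z => Omm (from_local p th z)) chi); auto.
- now apply open_from_local.
- now apply open_from_local.
- unfold Ck_near0 in hC; revert hC; apply filter_imp; intros s hs.
  apply (ex_derive_continuous (V := R_NormedModule)).
  apply (proj1 (hs 1%nat ltac:(lia))).
- assert (hO : locally ((0, 0) : pt) (fun z => Om (from_local p th z))).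
  { apply (continuous_from_local p th (0, 0)); rewrite from_local_origin.
    apply oOm, hGO, hp. }
  generalize (filter_and _ _ hl hO); apply filter_imp.
  intros z [a b]; rewrite <- hpart, <- a; tauto.
- apply closure_from_local; rewrite from_local_origin; apply hcl, hp.
- apply closure_from_local; rewrite from_local_origin; apply hcl, hp.
Qed.

Lemma trace_is_derive (D Gam : pt -> Prop) j q (chi : R -> R) k d t :
  open D -> Ck_upto (S j) D Gam q ->
  (forall e s, 0 < e < d -> Rabs s < d -> D (chi s + k * e, s)) ->
  k = 1 \/ k = -1 ->
  (forall s, Rabs s < d -> Gam (chi s, s)) ->
  (forall s, Rabs s < d -> ex_derive chi s) ->
  Rabs t < d -> continuous (Derive chi) t ->
  is_derive (fun s => trace D q (chi s, s)) t
    (trace D (pd1 q) (chi t, t) * Derive chi t + trace D (pd2 q) (chi t, t)).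
Proof.
intros oD hq hD hk hG dchi ht cchi'.
assert (hd : 0 < d) by (assert (h := Rabs_pos t); lra).
assert (hcl : forall s, Rabs s < d -> closure D (chi s, s))
  by (intros s hs; apply closure_graph with k d; auto).
destruct (hq) as [h0 [_ [h1 h2]]].
apply Ck_upto_0 in h1; apply Ck_upto_0 in h2.
apply is_derive_limit_along_graph with D Gam j q k d; auto; intros;
  apply extends_continuously_tends_in with Gam; auto.
Qed.

Theorem theorem1
  (Om Gam Omp Omm : pt -> Prop)
  (hOm_open : open Om) (hOm_conn : connected Om)
  (hGam : C2_curve Gam)
  (hdiv : divides Om Gam Omp Omm)
  (A : pt -> @matrix R 2 2) (Ap Am : @matrix R 2 2)
  (hAp : forall z, Omp z -> A z = Ap) (hAm : forall z, Omm z -> A z = Am)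
  (hAp_spd : sym_pos_def Ap) (hAm_spd : sym_pos_def Am)
  (sigma f u : pt -> R)
  (hsigma_nonneg : forall z, Om z -> ~ Gam z -> 0 <= sigma z)
  (hsigma_p : Ck_upto 0 Omp Gam sigma) (hsigma_m : Ck_upto 0 Omm Gam sigma)
  (hf_p : Ck_upto 0 Omp Gam f) (hf_m : Ck_upto 0 Omm Gam f)
  (hu_p : Ck_upto 2 Omp Gam u) (hu_m : Ck_upto 2 Omm Gam u)
  (n : pt -> pt) (hn : unit_normal_field Gam n)
  (w v : pt -> R) (hw : Ck_along 2 Gam w) (hv : Ck_along 1 Gam v)
  (hpde : forall z, Om z -> ~ Gam z ->
     div (fun y => mulmv (A y) (grad u y)) z - sigma z * u z = f z)
  (hjump_u : forall p, Gam p -> trace Omp u p - trace Omm u p = w p)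
  (hjump_flux : forall p, Gam p ->
     trace Omp (fun z => dot (mulmv (A z) (grad u z)) (n p)) p
     - trace Omm (fun z => dot (mulmv (A z) (grad u z)) (n p)) p = v p)
  (X Y th : R) (chi : R -> R)
  (hXY : Gam (X, Y)) (hth : n (X, Y) = (cos th, sin th))
  (hchi : local_graph Gam (X, Y) th chi) :
  (* the solution and the two parts in the coordinates (xi, eta) *)
  let ul := fun z => u (from_local (X, Y) th z) in
  let Dp := fun z => Omp (from_local (X, Y) th z) in
  let Dm := fun z => Omm (from_local (X, Y) th z) in
  let u_p := trace Dp ul (0, 0) in
  let u_m := trace Dm ul (0, 0) in
  let ux_p := trace Dp (pd1 ul) (0, 0) in
  let ux_m := trace Dm (pd1 ul) (0, 0) in
  let ue_p := trace Dp (pd2 ul) (0, 0) in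
  let ue_m := trace Dm (pd2 ul) (0, 0) in
  let uxx_p := trace Dp (pd1 (pd1 ul)) (0, 0) in
  let uxx_m := trace Dm (pd1 (pd1 ul)) (0, 0) in
  let uxe_p := trace Dp (pd2 (pd1 ul)) (0, 0) in
  let uxe_m := trace Dm (pd2 (pd1 ul)) (0, 0) in
  let uee_p := trace Dp (pd2 (pd2 ul)) (0, 0) in
  let uee_m := trace Dm (pd2 (pd2 ul)) (0, 0) in
  let jf := trace Omp f (X, Y) - trace Omm f (X, Y) in
  let sig_p := trace Omp sigma (X, Y) in
  let jsig := sig_p - trace Omm sigma (X, Y) in
  let ws := fun s => w (curve (X, Y) th chi s) in
  let vs := fun s => v (curve (X, Y) th chi s) in
  let w0 := ws 0 in
  let w1 := Derive ws 0 in
  let w2 := Derive_n ws 2 0 in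
  let v0 := vs 0 in
  let v1 := Derive vs 0 in
  let chi2 := Derive_n chi 2 0 in
  let p11 := a11 Ap th in
  let p12 := a12 Ap th in
  let p22 := a22 Ap th in
  let m11 := a11 Am th in
  let j11 := p11 - m11 in
  let j12 := p12 - a12 Am th in
  let j22 := p22 - a22 Am th in
  let S1 := (2 * p11 * p12 * j12 - 4 * p12 ^ 2 * j11 + p11 * p22 * j11)
            / p11 ^ 3 in
  let S2 := (2 * p11 * p12 * j22 - 4 * p12 ^ 2 * j12 + p11 * p22 * j12)
            / p11 ^ 3 in
  let S3 := - chi2 * ((4 * p12 ^ 2 - p11 * p22) / p11 ^ 3) * v0
            - 2 * p12 / p11 ^ 2 * v1
            + sig_p * w0 / p11
            - chi2 * ((3 * p11 * p12 * p22 - 4 * p12 ^ 3) / p11 ^ 3) * w1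
            + (2 * p12 ^ 2 - p11 * p22) / p11 ^ 2 * w2 in
  (forall q, In q [ul; pd1 ul; pd2 ul; pd1 (pd1 ul); pd2 (pd1 ul); pd2 (pd2 ul)] ->
     has_trace Dp q (0, 0) /\ has_trace Dm q (0, 0)) /\
  u_p = u_m + w0 /\
  ux_p = m11 / p11 * ux_m - j12 / p11 * ue_m + 1 / p11 * v0 - p12 / p11 * w1 /\
  ue_p = ue_m + w1 /\
  uee_p = chi2 * (j11 / p11) * ux_m + chi2 * (j12 / p11) * ue_m + uee_m
          - chi2 / p11 * v0 + chi2 * (p12 / p11) * w1 + w2 /\
  uxe_p = chi2 * ((p11 * j12 - 2 * p12 * j11) / p11 ^ 2) * ux_m
          + chi2 * ((p11 * j22 - 2 * p12 * j12) / p11 ^ 2) * ue_m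
          + m11 / p11 * uxe_m - j12 / p11 * uee_m
          + chi2 * (2 * p12 / p11 ^ 2) * v0 + 1 / p11 * v1
          + chi2 * ((p11 * p22 - 2 * p12 ^ 2) / p11 ^ 2) * w1
          - p12 / p11 * w2 /\
  uxx_p = - S1 * chi2 * ux_m - S2 * chi2 * ue_m + m11 / p11 * uxx_m
          + (2 * p12 * j12 - p11 * j22) / p11 ^ 2 * uee_m
          + 2 * (p12 * j11 - p11 * j12) / p11 ^ 2 * uxe_m
          + jf / p11 + jsig / p11 * u_m + S3.
Proof.
intros ul Dp Dm u_p u_m ux_p ux_m ue_p ue_m uxx_p uxx_m uxe_p uxe_m uee_p uee_m
  jf sig_p jsig ws vs w0 w1 w2 v0 v1 chi2 p11 p12 p22 m11 j11 j12 j22 S1 S2 S3.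
destruct (local_parts Om Gam Omp Omm (X, Y) th chi hOm_open hdiv hXY hchi)
  as [k [d1 [hk [hd1 strip]]]].
assert (hnn := unit_normal_field_graph Gam n (X, Y) th chi hn hXY hth hchi).
destruct hdiv as [hGO [op [om [disj [hpart _]]]]].
destruct hchi as [hC [chi0 [dchi0 hl]]].
assert (cchi0 : continuous chi 0).
{ apply (ex_derive_continuous (V := R_NormedModule)).
  apply (proj1 (locally_singleton _ _ hC 1%nat ltac:(lia))). }
assert (hG : locally 0 (fun s => Gam (from_local (X, Y) th (chi s, s)))).
{ assert (hz := continuous_pair chi (fun s => s) 0 cchi0 (continuous_id 0)).
  cbv beta in hz; rewrite chi0 in hz; generalize (hz _ hl).
  unfold filtermap; apply filter_imp; intros s hs; now apply hs. }
assert (hd1' : locally 0 (fun s => Rabs s < d1)).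
{ exists (mkposreal _ hd1); intros y hy; unfold ball in hy; simpl in hy.
  unfold AbsRing_ball, abs, minus, plus, opp in hy; simpl in hy.
  now rewrite Ropp_0, Rplus_0_r in hy. }
destruct (filter_and _ _ (filter_and _ _ hd1' hG) (filter_and _ _ hnn hC))
  as [d hd].
assert (near : forall s, Rabs s < d -> Rabs s < d1 /\
  Gam (from_local (X, Y) th (chi s, s)) /\
  n (curve (X, Y) th chi s) = normal th chi s /\
  ex_derive chi s /\ continuous (Derive chi) s /\ ex_derive (Derive chi) s).
{ intros s hs; destruct (hd s) as [[a b] [c e]].
  - unfold ball; simpl; unfold AbsRing_ball, abs, minus, plus, opp; simpl.
    now rewrite Ropp_0, Rplus_0_r.
  - destruct (e 1%nat ltac:(lia)), (e 2%nat ltac:(lia)); repeat split; auto. }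
clear hd.
assert (near0 : Rabs 0 < d) by (rewrite Rabs_R0; apply cond_pos).
(* Otherwise [near] would apply at [s = d1] and give [d1 < d1]. *)
assert (d_d1 : d <= d1).
{ apply Rnot_lt_le; intros h; destruct (near d1); [rewrite Rabs_pos_eq; lra|].
  rewrite Rabs_pos_eq in *; lra. }
assert (dpos := cond_pos d).
assert (locd : locally 0 (fun s => Rabs s < d)).
{ exists d; intros y hy; unfold ball in hy; simpl in hy.
  unfold AbsRing_ball, abs, minus, plus, opp in hy; simpl in hy.
  now rewrite Ropp_0, Rplus_0_r in hy. }
assert (stripp : forall e s, 0 < e < d -> Rabs s < d -> Dp (chi s + k * e, s))
  by (intros; apply strip; lra).
assert (stripm : forall e s, 0 < e < d -> Rabs s < d -> Dm (chi s + - k * e, s))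
  by (intros; apply strip; lra).
assert (hk' : - k = 1 \/ - k = -1) by lra.
assert (clp : forall s, Rabs s < d -> closure Dp (chi s, s))
  by (intros s hs; apply closure_graph with k d; auto).
assert (clm : forall s, Rabs s < d -> closure Dm (chi s, s))
  by (intros s hs; apply closure_graph with (- k) d; auto).
assert (Clp : forall s, Rabs s < d -> closure Omp (from_local (X, Y) th (chi s, s)))
  by (intros s hs; apply closure_from_local, clp, hs).
assert (Clm : forall s, Rabs s < d -> closure Omm (from_local (X, Y) th (chi s, s)))
  by (intros s hs; apply closure_from_local, clm, hs).
set (Gl := fun z => Gam (from_local (X, Y) th z)).
assert (hGl : forall s, Rabs s < d -> Gl (chi s, s)) by (intros s hs; apply near, hs).
assert (dchi : forall s, Rabs s < d -> ex_derive chi s)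
  by (intros s hs; apply near, hs).
assert (oDp := open_from_local Omp (X, Y) th op : open Dp).
assert (oDm := open_from_local Omm (X, Y) th om : open Dm).
assert (hulp := Ck_upto_from_local Omp Gam 2 u (X, Y) th op hu_p : Ck_upto 2 Dp Gl ul).
assert (hulm := Ck_upto_from_local Omm Gam 2 u (X, Y) th om hu_m : Ck_upto 2 Dm Gl ul).
assert (hup1 : Ck_upto 1 Omp Gam u) by now apply Ck_upto_pred.
assert (hum1 : Ck_upto 1 Omm Gam u) by now apply Ck_upto_pred.
set (P := fun s => trace Dp (pd1 ul) (chi s, s)).
set (Q := fun s => trace Dp (pd2 ul) (chi s, s)).
set (P' := fun s => trace Dm (pd1 ul) (chi s, s)).
set (Q' := fun s => trace Dm (pd2 ul) (chi s, s)).
(* Required on a whole interval, because the resulting formula for the derivative of [ws] is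
   differentiated again. *)
assert (dU : forall s, Rabs s < d ->
  is_derive (fun s => trace Dp ul (chi s, s)) s (P s * Derive chi s + Q s))
  by (intros s hs; apply trace_is_derive with Gl 1%nat k d; auto; apply near, hs).
assert (dU' : forall s, Rabs s < d ->
  is_derive (fun s => trace Dm ul (chi s, s)) s (P' s * Derive chi s + Q' s))
  by (intros s hs; apply trace_is_derive with Gl 1%nat (- k) d; auto; apply near, hs).
(* At 0 the graph is tangent to the eta axis, so only the eta partial remains. Applied to the first
   partials of [ul], this produces the mixed and the pure eta second derivatives. *)
assert (at0 : forall (D : pt -> Prop) q c, open D -> Ck_upto 1 D Gl q ->
  (forall e s, 0 < e < d -> Rabs s < d -> D (chi s + c * e, s)) ->
  c = 1 \/ c = -1 ->
  is_derive (fun s => trace D q (chi s, s)) 0 (trace D (pd2 q) (0, 0))).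
{ intros D q c oD hq hD hc; evar_last.
  - apply trace_is_derive with Gl 0%nat c d; auto; apply near, near0.
  - rewrite dchi0, chi0; ring. }
assert (dP : is_derive P 0 uxe_p) by (apply at0 with k; auto; apply hulp).
assert (dQ : is_derive Q 0 uee_p) by (apply at0 with k; auto; apply hulp).
assert (dP' : is_derive P' 0 uxe_m) by (apply at0 with (- k); auto; apply hulm).
assert (dQ' : is_derive Q' 0 uee_m) by (apply at0 with (- k); auto; apply hulm).
assert (dg : is_derive (Derive chi) 0 chi2) by (apply Derive_correct, near, near0).
assert (Ews : locally 0 (fun s => trace Dp ul (chi s, s) - trace Dm ul (chi s, s) = ws s)).
{ revert locd; apply filter_imp; intros s hs.
  unfold ws; rewrite <- hjump_u by (apply near, hs).
  unfold Dp, Dm, ul, curve.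
  rewrite (trace_from_local Omp Gam), (trace_from_local Omm Gam); auto.
  - apply hu_m.
  - apply near, hs.
  - apply hu_p.
  - apply near, hs. }
set (flux M (P Q : R -> R) s := (a11 M th * P s + a12 M th * Q s
  - Derive chi s * (a12 M th * P s + a22 M th * Q s)) / sqrt (1 + Derive chi s ^ 2)).
assert (Evs : locally 0 (fun s => flux Ap P Q s - flux Am P' Q' s = vs s)).
{ revert locd; apply filter_imp; intros s hs.
  destruct (near s hs) as [_ [hGs [hns _]]].
  unfold vs; rewrite <- hjump_flux by exact hGs; rewrite hns.
  unfold curve.
  rewrite (trace_flux Omp Gam A Ap), (trace_flux Omm Gam A Am); auto;
    [apply hAm_spd | apply hAp_spd]. }
assert (Edws : locally 0 (fun s =>
  (P s - P' s) * Derive chi s + (Q s - Q' s) = Derive ws s)).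
{ generalize (filter_and _ _ locd (locally_locally _ _ Ews)); apply filter_imp.
  intros s [hs es]; symmetry; apply is_derive_unique.
  apply (is_derive_ext_loc _ _ _ _ es); evar_last.
  - apply (is_derive_minus (V := R_NormedModule)); [apply dU, hs | apply dU', hs].
  - unfold minus, plus, opp; simpl; ring. }
assert (EP0 : P 0 = ux_p) by (unfold P; now rewrite chi0).
assert (EQ0 : Q 0 = ue_p) by (unfold Q; now rewrite chi0).
assert (EP0' : P' 0 = ux_m) by (unfold P'; now rewrite chi0).
assert (EQ0' : Q' 0 = ue_m) by (unfold Q'; now rewrite chi0).
assert (J0 : u_p - u_m = w0).
{ unfold w0; rewrite <- (locally_singleton _ _ Ews), chi0; reflexivity. }
assert (J1 : ue_p - ue_m = w1).
{ unfold w1; rewrite <- (locally_singleton _ _ Edws), dchi0, EQ0, EQ0'; ring. }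
(* Differentiating the product, the term with the jump of the mixed derivative is multiplied by
   [Derive chi 0 = 0]; the curvature term with [chi2] is what remains of it. *)
assert (J2 : (ux_p - ux_m) * chi2 + (uee_p - uee_m) = w2).
{ unfold w2; symmetry; apply (is_derive_unique (Derive ws)).
  apply (is_derive_ext_loc _ _ _ _ Edws); evar_last.
  - apply (is_derive_plus (V := R_NormedModule)).
    + apply (is_derive_mult (K := R_AbsRing) (fun s => P s - P' s) (Derive chi) 0
        (uxe_p - uxe_m) chi2);
        [apply (is_derive_minus (V := R_NormedModule) P P'); auto | auto | apply Rmult_comm].
    + apply (is_derive_minus (V := R_NormedModule)); [exact dQ | exact dQ'].
  - unfold minus, plus, opp, mult; simpl; rewrite dchi0, EP0, EP0'; ring. }
assert (J3 : (p11 * ux_p + p12 * ue_p) - (m11 * ux_m + a12 Am th * ue_m) = v0).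
{ unfold v0; rewrite <- (locally_singleton _ _ Evs); unfold flux.
  rewrite dchi0, EP0, EQ0, EP0', EQ0'; replace (1 + 0 ^ 2) with 1 by ring.
  rewrite sqrt_1; unfold p11, p12, m11; field. }
(* The flux relation holds for all [s] near 0, with the normal turning along the curve; its rotation
   is the source of the [chi2] terms. *)
assert (J4 : (p11 * uxe_p + p12 * uee_p - chi2 * (p12 * ux_p + p22 * ue_p))
  - (m11 * uxe_m + a12 Am th * uee_m - chi2 * (a12 Am th * ux_m + a22 Am th * ue_m)) = v1).
{ unfold v1; symmetry; apply is_derive_unique.
  apply (is_derive_ext_loc _ _ _ _ Evs).
  rewrite <- EP0, <- EQ0, <- EP0', <- EQ0'.
  apply (is_derive_minus (V := R_NormedModule)); apply flux_is_derive_0; auto. }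
assert (Epde : forall z, Omp z \/ Omm z ->
  div (fun y => mulmv (A y) (grad u y)) z - sigma z * u z = f z)
  by (intros z hz; apply hpart in hz; apply hpde; apply hz).
assert (hGo : Gam (from_local (X, Y) th (0, 0))) by now rewrite from_local_origin.
assert (J5 := trace_pde Omp Gam A Ap sigma f u (X, Y) th (0, 0) op hu_p
  (proj1 hsigma_p) (proj1 hf_p) hAp (proj1 hAp_spd)
  (fun z hz => Epde z (or_introl hz)) hGo).
assert (J6 := trace_pde Omm Gam A Am sigma f u (X, Y) th (0, 0) om hu_m
  (proj1 hsigma_m) (proj1 hf_m) hAm (proj1 hAm_spd)
  (fun z hz => Epde z (or_intror hz)) hGo).
assert (C1 := Clp 0 near0); assert (C2 := Clm 0 near0); rewrite chi0 in C1, C2.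
specialize (J5 C1); specialize (J6 C2); cbv zeta in J5, J6.
rewrite from_local_origin in J5, J6.
split.
- assert (Tp : forall q, extends_continuously Dp Gl q -> has_trace Dp q (0, 0)).
  { intros q hq; eexists; apply extends_continuously_tends_in with Gl; auto.
    rewrite <- chi0 at 1; auto. }
  assert (Tm : forall q, extends_continuously Dm Gl q -> has_trace Dm q (0, 0)).
  { intros q hq; eexists; apply extends_continuously_tends_in with Gl; auto.
    rewrite <- chi0 at 1; auto. }
  destruct hulp as [a0 [_ [[a1 [_ [[b11 _] [b12 _]]]] [a2 [_ [_ [b22 _]]]]]]].
  destruct hulm as [a0' [_ [[a1' [_ [[b11' _] [b12' _]]]] [a2' [_ [_ [b22' _]]]]]]].
  simpl; intros q hq; repeat destruct hq as [<-|hq]; try contradiction; auto.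
- exact (jump_algebra p11 p12 p22 m11 (a12 Am th) (a22 Am th) u_m u_p ux_m ux_p
    ue_m ue_p uxx_m uxx_p uxe_m uxe_p uee_m uee_p w0 w1 w2 v0 v1 chi2 _ _ _ _
    (a11_pos Ap th hAp_spd) J0 J1 J2 J3 J4 J5 J6).
Qed.
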